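(* Let $G=\mathrm{Aut}(\mathbb{Q})$ be the group of order-preserving bijections of $\mathbb{Q}$, with the topology of pointwise convergence. Then every two-dimensional topological similarity class is meager in $G\times G$; that is, for every pair $(f_1,g_1)\in G\times G$, the set of pairs $(f,g)\in G\times G$ that are topologically similar to $(f_1,g_1)$ is meager in $G\times G$.
   Context: $\mathbb{Q}$ is the set of rationals with its usual linear order. The topology on $G=\mathrm{Aut}(\mathbb{Q})$ has as basic open sets $U(p)=\{g\in G: g \text{ extends } p\}$, where $p$ ranges over order-preserving bijections between finite subsets of $\mathbb{Q}$. For a topological group $K$, a pair $(g_1,g_2)\in K^2$ is topologically similar to $(f_1,f_2)\in K^2$ if the map $g_i\mapsto f_i$ ($i=1,2$) extends to a group isomorphism $\langle g_1,g_2\rangle\to\langle f_1,f_2\rangle$ that is a homeomorphism with respect to the subspace topologies. This is an equivalence relation; its classes are the two-dimensional topological similarity classes. *)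

(* Defs.v *)
From HB Require Import structures.
From mathcomp Require Import all_boot all_order all_algebra.
Set Implicit Arguments. Unset Strict Implicit. Unset Printing Implicit Defensive.
Import Order.TTheory GRing.Theory Num.Theory.
Local Open Scope ring_scope.

Definition pset (T : Type) := T -> Prop.

Section GenTop.
Variables (T : Type) (X : pset T) (isopen : pset T -> Prop).

Definition closure (A : pset T) : pset T :=
  fun x => X x /\ forall O, isopen O -> O x -> exists y, O y /\ A y.
Definition interior (B : pset T) : pset T :=
  fun x => exists O, isopen O /\ O x /\ forall y, O y -> B y.
Definition nowhere_dense (A : pset T) : Prop :=
  forall x, ~ interior (closure A) x.
Definition meager (A : pset T) : Prop :=
  exists N : nat -> pset T, (forall n, nowhere_dense (N n)) /\
    forall x, A x -> exists n, N n x.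
Definition sub_open (S : pset T) (O : pset T) : Prop :=
  (forall x, O x -> S x) /\
  exists U, isopen U /\ forall x, S x -> (O x <-> U x).
Definition sub_continuous (S S' : pset T) (phi : T -> T) : Prop :=
  forall O', sub_open S' O' -> sub_open S (fun x => S x /\ O' (phi x)).
End GenTop.

Definition is_aut (f : rat -> rat) : Prop :=
  bijective f /\ forall x y : rat, x < y -> f x < f y.

(* p : order-preserving bijection between finite subsets of Q, as a list of pairs *)
Definition partial_iso (p : seq (rat * rat)) : Prop :=
  forall a b, a \in p -> b \in p ->
    (a.1 == b.1) = (a.2 == b.2) /\ (a.1 < b.1) = (a.2 < b.2).

Definition Ubasic (p : seq (rat * rat)) : pset (rat -> rat) :=
  fun g => is_aut g /\ forall a, a \in p -> g a.1 = a.2.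

Definition G_open (U : pset (rat -> rat)) : Prop :=
  (forall f, U f -> is_aut f) /\
  forall f, U f -> exists p, partial_iso p /\ Ubasic p f /\
                    forall g, Ubasic p g -> U g.

Definition G2 : pset ((rat -> rat) * (rat -> rat)) :=
  fun x => is_aut x.1 /\ is_aut x.2.
Definition G2_open (W : pset ((rat -> rat) * (rat -> rat))) : Prop :=
  (forall x, W x -> G2 x) /\
  forall x, W x -> exists U V, G_open U /\ G_open V /\ U x.1 /\ V x.2 /\
     forall y, U y.1 -> V y.2 -> W y.

Inductive gen (g1 g2 : rat -> rat) : pset (rat -> rat) :=
| gen_g1 : gen g1 g2 g1
| gen_g2 : gen g1 g2 g2
| gen_id : gen g1 g2 id
| gen_mul h k : gen g1 g2 h -> gen g1 g2 k -> gen g1 g2 (h \o k)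
| gen_inv h k : gen g1 g2 h -> cancel h k -> cancel k h -> gen g1 g2 k.

Definition top_similar (g1 g2 f1 f2 : rat -> rat) : Prop :=
  exists phi psi : (rat -> rat) -> (rat -> rat),
    phi g1 = f1 /\ phi g2 = f2 /\
    (forall h, gen g1 g2 h -> gen f1 f2 (phi h)) /\
    (forall k, gen f1 f2 k -> gen g1 g2 (psi k)) /\
    (forall h, gen g1 g2 h -> psi (phi h) = h) /\
    (forall k, gen f1 f2 k -> phi (psi k) = k) /\
    (forall h k, gen g1 g2 h -> gen g1 g2 k -> phi (h \o k) = phi h \o phi k) /\
    sub_continuous G_open (gen g1 g2) (gen f1 f2) phi /\
    sub_continuous G_open (gen f1 f2) (gen g1 g2) psi.

(* Main.v *)
Require Import Defs.
From HB Require Import structures.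
From mathcomp Require Import all_boot all_order all_algebra.
From mathcomp Require Import lra.
From Stdlib Require Import Classical FunctionalExtensionality.
Set Implicit Arguments. Unset Strict Implicit. Unset Printing Implicit Defensive.
Import Order.TTheory GRing.Theory Num.Theory.
Local Open Scope ring_scope.

(** A topological isomorphism sending [(f, g)] to [(f1, g1)] is continuous at
    the identity in both directions: for every point [x] there is a finite set
    [S] such that every word [w] for which [w(f1, g1)] fixes [S] pointwise
    satisfies [w(f, g) x = x].

    For a generic pair, every finite set is fixed pointwise by some reduced
    word containing [f^k g^k], with [k] arbitrarily large.  Indeed, a pair of
    finite partial automorphisms extends to a pair that moves all non-fixed
    points of a given finite set, by one common word [u], into intervals on
    each of which one of [f], [g] is the identity; then
    [u^-1 [f^k, g^k] u] fixes the set.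

    Conversely, fix words [w_k], each reduced and containing [f^k g^k].  A
    finite partial pair cannot force [w_k x = x] for all [k] unless [x] is a
    common fixed point: reading [f^k g^k] inside a partial pair of size less
    than [k] is only possible at a common fixed point, and once a reduced word
    leaves the domain its final value can be chosen freely.  So if a similarity
    class contains a generic pair, it is covered by countably many nowhere dense
    sets; if it contains none, it is meager anyway. *)

(** * Automorphisms of the rationals *)

Lemma aut_lt f : is_aut f -> {mono f : x y / x < y}.
Proof.
move=> [bf hf] x y; apply/idP/idP => [|/hf//].
by case: (ltgtP x y) => // [/hf|->]; [lra | rewrite ltxx].
Qed.

Lemma aut_le f : is_aut f -> {mono f : x y / x <= y}.
Proof. by move=> hf x y; rewrite !leNgt aut_lt. Qed.

Lemma aut_inj f : is_aut f -> injective f.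
Proof. by move=> [/bij_inj]. Qed.

Lemma id_aut : is_aut id.
Proof. by split=> //; exists id. Qed.

Lemma comp_aut f g : is_aut f -> is_aut g -> is_aut (f \o g).
Proof.
move=> [bf hf] [bg hg]; split; first exact: bij_comp.
by move=> x y /hg /hf.
Qed.

Lemma inv_aut f h : is_aut f -> cancel f h -> cancel h f -> is_aut h.
Proof.
move=> hf fK hK; split; first by exists f.
by move=> x y; rewrite -{1}(hK x) -{1}(hK y) aut_lt.
Qed.

(** Both maps carry the half-lines cut at [c] to the half-lines cut at the common value, so their
    inverses glue there as well. *)
Lemma glue_aut a b c : is_aut a -> is_aut b -> a c = b c ->
  is_aut (fun t => if t <= c then a t else b t).
Proof.
move=> ha hb eqc; split.
  have [[ai aK Ka] _] := ha; have [[bi bK Kb] _] := hb.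
  exists (fun y => if y <= a c then ai y else bi y) => t.
    case: (leP t c) => tc; first by rewrite (aut_le ha) tc aK.
    by rewrite eqc (aut_le hb) leNgt tc bK.
  case: (leP t (a c)) => tc.
    have -> : ai t <= c by rewrite -(aut_le ha) Ka.
    exact: Ka.
  have -> : (bi t <= c) = false by rewrite -(aut_le hb) Kb -eqc leNgt tc.
  exact: Kb.
move=> x y xy; case: (leP x c) => xc; case: (leP y c) => yc.
- by rewrite aut_lt.
- apply: (@le_lt_trans _ _ (a c)); first by rewrite aut_le.
  by rewrite eqc aut_lt.
- lra.
- by rewrite aut_lt.
Qed.

Lemma affine_aut (m x0 y0 : rat) : 0 < m -> is_aut (fun t => y0 + m * (t - x0)).
Proof.
move=> m0; split.
  exists (fun y => x0 + m^-1 * (y - y0)) => t.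
    by rewrite addrAC subrr add0r mulKf ?gt_eqF// addrC subrK.
  by rewrite [x0 + _]addrC addrK mulVKf ?gt_eqF// addrC subrK.
by move=> x y xy; rewrite ltrD2l ltr_pM2l // ltrD2r.
Qed.

(** Piecewise affine: [a] runs from [(lo, lo)] to [(v, y)], [b] from [(v, y)] to [(hi, hi)], and the
    identity takes over outside. *)
Lemma bump_aut (lo hi v y : rat) : lo < v < hi -> lo < y < hi ->
  exists h, [/\ is_aut h, h v = y & forall t, t <= lo \/ hi <= t -> h t = t].
Proof.
move=> /andP[lv vh] /andP[ly yh].
pose a t : rat := y + ((y - lo) / (v - lo)) * (t - v).
pose b t : rat := y + ((hi - y) / (hi - v)) * (t - v).
have ha : is_aut a by apply: affine_aut; apply: divr_gt0; lra.
have hb : is_aut b by apply: affine_aut; apply: divr_gt0; lra.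
have alo : a lo = lo.
  rewrite /a -(opprB v lo) mulrN divfK; last by apply/eqP; lra.
  lra.
have bhi : b hi = hi.
  rewrite /b divfK; last by apply/eqP; lra.
  lra.
have h1 := @glue_aut id a lo id_aut ha (esym alo).
have h2 := @glue_aut b id hi hb id_aut bhi.
have E : (if v <= lo then v else a v) = (if v <= hi then b v else v).
  by rewrite leNgt lv /= (ltW vh) /a /b subrr !mulr0.
exists (fun t => if t <= v then if t <= lo then t else a t
                 else if t <= hi then b t else t); split.
- exact: (@glue_aut _ _ v h1 h2 E).
- by rewrite lexx leNgt lv /= /a subrr mulr0 addr0.
- move=> t [tl|th].
    by rewrite tl (le_trans tl (ltW lv)).
  have tv : (t <= v) = false by apply/negbTE; rewrite -ltNge (lt_le_trans vh).
  rewrite tv; case: (leP t hi) => // thi.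
  by have -> : t = hi by lra.
Qed.

Lemma seq_min (s : seq rat) : s <> [::] ->
  exists2 m, m \in s & forall x, x \in s -> m <= x.
Proof.
elim: s => // a s IH _; case: s IH => [|b s] IH.
  by exists a; rewrite ?mem_head // => x; rewrite inE => /eqP->.
have [//|m ms mm] := IH.
case: (leP a m) => am.
  exists a; first exact: mem_head.
  by move=> x; rewrite inE => /orP[/eqP->//|/mm]; apply: le_trans.
exists m; first by rewrite inE ms orbT.
by move=> x; rewrite inE => /orP[/eqP->|/mm//]; exact: ltW.
Qed.

Lemma seq_max (s : seq rat) : s <> [::] ->
  exists2 m, m \in s & forall x, x \in s -> x <= m.
Proof.
move=> s0; have [|m ms mm] := @seq_min [seq - x | x <- s]; first by case: s s0.
move/mapP: ms => [y ys mE]; exists y => // x xs.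
by have := mm (- x) (map_f _ xs); lra.
Qed.

(** The gap is closed on the right, so [y] itself avoids [s]; it serves both as a fresh value and as
    a boundary between blocks. *)
Lemma right_gap (s : seq rat) (v : rat) :
  exists2 y, v < y & forall e, e \in s -> e <= v \/ y < e.
Proof.
elim: s => [|a s [y vy hy]]; first by exists (v + 1); [lra|].
case: (leP a v) => av.
  by exists y => // e; rewrite inE => /orP[/eqP->|/hy]; [left|].
case: (ltP y a) => ya.
  by exists y => // e; rewrite inE => /orP[/eqP->|/hy//]; right.
exists ((v + a) / 2); first lra.
move=> e; rewrite inE => /orP[/eqP->|/hy[]]; [right; lra|by left|right; lra].
Qed.

Lemma left_gap (s : seq rat) (v : rat) :
  exists2 y, y < v & forall e, e \in s -> v <= e \/ e < y.
Proof.
have [y vy hy] := right_gap [seq - x | x <- s] (- v).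
exists (- y); first lra.
by move=> e es; case: (hy (- e) (map_f _ es)) => ?; [left|right]; lra.
Qed.

(** * Finite partial isomorphisms *)

Lemma partial_iso_cons p x y : partial_iso p ->
  (forall a, a \in p -> (a.1 < x) = (a.2 < y) /\ (x < a.1) = (y < a.2)) ->
  partial_iso ((x, y) :: p).
Proof.
move=> hp h.
have E a : a \in p -> (a.1 == x) = (a.2 == y).
  by move=> /h[h1 h2]; rewrite !eq_le !leNgt h1 h2.
move=> a b; rewrite !inE => /predU1P[->|ap] /predU1P[->|bp] /=.
- by rewrite !eqxx !ltxx.
- by rewrite !(eq_sym _ b.1) !(eq_sym _ b.2) E //; case: (h b bp).
- by rewrite E //; case: (h a ap).
- exact: hp.
Qed.

Lemma partial_iso_behead a p : partial_iso (a :: p) -> partial_iso p.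
Proof. by move=> hp b c bp cp; apply: hp; rewrite inE ?bp ?cp orbT. Qed.

Lemma partial_iso_sub p p' : {subset p' <= p} -> partial_iso p -> partial_iso p'.
Proof. by move=> s hp a b /s ap /s bp; exact: hp. Qed.

Lemma Ubasic_partial_iso p f : Ubasic p f -> partial_iso p.
Proof.
move=> [hf hp] a b ap bp; rewrite -!hp //.
by rewrite (inj_eq (aut_inj hf)) aut_lt.
Qed.

Lemma Ubasic_cat p p' f : Ubasic (p ++ p') f <-> Ubasic p f /\ Ubasic p' f.
Proof.
split=> [[hf h]|[[hf h] [_ h']]].
  by split; split=> // a ap; apply: h; rewrite mem_cat ap ?orbT.
by split=> // a; rewrite mem_cat => /orP[/h|/h'].
Qed.

Lemma Ubasic_cons a p f : Ubasic (a :: p) f <-> f a.1 = a.2 /\ Ubasic p f.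
Proof.
split=> [[hf h]|[fa [hf h]]].
  by split; [apply: h; exact: mem_head | split=> // b bp; apply: h; rewrite inE bp orbT].
by split=> // b; rewrite inE => /predU1P[->|/h].
Qed.

(** Induction on [p]: an extension [f] of the tail is corrected at [x] by a bump carrying [f x] to
    [y]. Since [f x] and [y] compare in the same way with every value of the tail, no such value
    lies between them, and the bump can be supported away from all of them. *)
Lemma partial_iso_extend p : partial_iso p -> exists f, Ubasic p f.
Proof.
elim: p => [|[x y] p IH] hp; first by exists id; split=> //; exact: id_aut.
have [f [hf fp]] := IH (partial_iso_behead hp).
have key a : a \in p ->
    [/\ (a.1 == x) = (a.2 == y), (a.1 < x) = (a.2 < y) & (x < a.1) = (y < a.2)].
  move=> ap; have ap' : a \in (x, y) :: p by rewrite inE ap orbT.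
  have [/= h1 h2] := hp _ _ ap' (mem_head _ _).
  by have [/= _ h3] := hp _ _ (mem_head _ _) ap'.
have [fxy|fxy] := eqVneq (f x) y.
  by exists f; apply/Ubasic_cons; split.
pose lo0 := Order.min (f x) y; pose hi0 := Order.max (f x) y.
have [lo lol hlo] := left_gap (map snd p) lo0.
have [hi hih hhi] := right_gap (map snd p) hi0.
have l1 : lo0 <= f x <= hi0 by rewrite ge_min le_max !lexx.
have l2 : lo0 <= y <= hi0 by rewrite ge_min le_max !lexx !orbT.
have [||h [ha hv hid]] := @bump_aut lo hi (f x) y.
- by move/andP: l1 => [? ?]; apply/andP; split; lra.
- by move/andP: l2 => [? ?]; apply/andP; split; lra.
exists (h \o f); apply/Ubasic_cons; split=> //; split; first exact: comp_aut.
move=> a ap /=; rewrite (fp _ ap); apply: hid.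
have [k1 k2 k3] := key _ ap.
have sa := map_f snd ap.
have {}k2 : (a.2 < f x) = (a.2 < y) by rewrite -k2 -(fp _ ap) aut_lt.
have {}k3 : (f x < a.2) = (y < a.2) by rewrite -k3 -(fp _ ap) aut_lt.
have k1' : (a.2 == f x) = (a.2 == y) by rewrite -k1 -(fp _ ap) (inj_eq (aut_inj hf)).
have ny : a.2 != y.
  by apply/negP => e; move: (e); rewrite -k1' => /eqP e'; move: fxy; rewrite -e' e.
have [ly|ly] := ltP a.2 y.
  left; case: (hlo _ sa) => [|/ltW//]; rewrite /lo0 ge_min.
  by rewrite leNgt k2 ly leNgt ly.
have {}ly : y < a.2 by rewrite lt_neqAle eq_sym ny.
right; case: (hhi _ sa) => [|/ltW//]; rewrite /hi0 le_max.
by rewrite leNgt k3 ly leNgt ly.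
Qed.

(** * Words in two automorphisms *)

(* [(i, e)] is the generator [i] ([false] for the first one, [true] for the
   second one), inverted when [e] holds. *)
Definition letter := (bool * bool)%type.

Definition linv (l : letter) : letter := (l.1, ~~ l.2).

Lemma linvK : involutive linv.
Proof. by move=> [i e]; rewrite /linv /= negbK. Qed.

(** [is_aut] provides an inverse only existentially, so the action of the letters is carried as
    data. As [linv] is involutive, [rep_K] gives both cancellation laws. *)
Record represents (f g : rat -> rat) (A : letter -> rat -> rat) : Prop := Represents {
  rep_fst : is_aut f;
  rep_snd : is_aut g;
  rep_f : A (false, false) =1 f;
  rep_g : A (true, false) =1 g;
  rep_K : forall l, cancel (A l) (A (linv l)) }.

Lemma represents_ex f g : is_aut f -> is_aut g -> exists A, represents f g A.
Proof.
move=> hf hg; have [[fi fK Kf] _] := hf; have [[gi gK Kg] _] := hg.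
exists (fun l => if l.1 then if l.2 then gi else g else if l.2 then fi else f).
by split=> // -[[] []] x /=; rewrite ?fK ?Kf ?gK ?Kg.
Qed.

Section Action.
Variables (f g : rat -> rat) (A : letter -> rat -> rat).
Hypothesis hA : represents f g A.

Lemma rep_VK l : cancel (A (linv l)) (A l).
Proof. by move=> x; rewrite -{1}(linvK l) (rep_K hA). Qed.

Lemma letter_aut l : is_aut (A l).
Proof.
have pos i : is_aut (A (i, false)).
  case: i; first by rewrite (functional_extensionality _ _ (rep_g hA)); case: hA.
  by rewrite (functional_extensionality _ _ (rep_f hA)); case: hA.
case: l => i [] //; apply: (inv_aut (pos i)); first exact: (rep_K hA (i, false)).
exact: (rep_VK (i, false)).
Qed.

End Action.

(** The leftmost letter acts first, the opposite of composition order. *)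
Definition wact (A : letter -> rat -> rat) (w : seq letter) (x : rat) : rat :=
  foldl (fun y l => A l y) x w.

Arguments wact : simpl never.

Lemma wact_cons A l w x : wact A (l :: w) x = wact A w (A l x).
Proof. by []. Qed.

Lemma wact_cat A w w' x : wact A (w ++ w') x = wact A w' (wact A w x).
Proof. exact: foldl_cat. Qed.

Definition winv (w : seq letter) : seq letter := rev (map linv w).

Section WordAction.
Variables (f g : rat -> rat) (A : letter -> rat -> rat).
Hypothesis hA : represents f g A.

Lemma wactK w : cancel (wact A w) (wact A (winv w)).
Proof.
elim: w => //= l w IH x; rewrite wact_cons /winv /= rev_cons -cats1 wact_cat.
by rewrite -/(winv w) IH wact_cons (rep_K hA).
Qed.

Lemma wact_aut w : is_aut (wact A w).
Proof.
elim: w => [|l w IH]; first exact: id_aut.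
exact: (comp_aut IH (letter_aut hA l)).
Qed.

Lemma wact_fixed w x : f x = x -> g x = x -> wact A w x = x.
Proof.
move=> fx gx; have pos i : A (i, false) x = x.
  by case: i; rewrite ?(rep_f hA) ?(rep_g hA).
have fixl l : A l x = x.
  case: l => i [] //; rewrite -{1}(pos i); exact: (rep_K hA (i, false)).
by elim: w => //= l w IH; rewrite wact_cons fixl.
Qed.

Lemma wact_nseq_fixed l n x : A l x = x -> wact A (nseq n l) x = x.
Proof. by move=> lx; elim: n => //= n IH; rewrite wact_cons lx. Qed.

End WordAction.

Definition reduced : pred (seq letter) := sorted (fun l l' => l' != linv l).

Lemma reduced_cat (l0 : letter) s1 s2 : reduced s1 -> reduced s2 ->
  [\/ nilp s1, nilp s2 | head l0 s2 != linv (last l0 s1)] -> reduced (s1 ++ s2).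
Proof.
rewrite /reduced; case: s1 => //= x s1 h1; case: s2 => [|y s2] h2; first by rewrite cats0.
by case=> //= h; rewrite cat_path /= h1 h.
Qed.

Lemma reduced_winv w : reduced w -> reduced (winv w).
Proof.
rewrite /reduced /winv rev_sorted sorted_map; apply: sub_sorted => l l' /= h.
by apply: contra h => /eqP ->; rewrite linvK.
Qed.

Lemma reduced_nseq n l : reduced (nseq n l).
Proof.
case: n => //= n; elim: n => //= n ->; rewrite andbT.
by case: l => i []; rewrite /linv /= xpair_eqE andbF.
Qed.

(** Free reduction: a new letter cancels the head of the reduced tail or stays in front of it. The
    reduced word is chosen before the pair. *)
Lemma reduce_ex w : exists2 w', reduced w' &
  forall f g A, represents f g A -> wact A w' =1 wact A w.
Proof.
elim: w => [|l w [w' rw' hw']]; first by exists [::].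
case: w' rw' hw' => [|l' w'] rw' hw'.
  by exists [:: l] => // f g A hA x; rewrite !wact_cons -(hw' _ _ _ hA).
have [e|ne] := eqVneq l' (linv l).
  exists w'; first exact: path_sorted rw'.
  move=> f g A hA x; rewrite !wact_cons -(hw' _ _ _ hA) wact_cons e.
  by rewrite (rep_K hA).
exists [:: l, l' & w']; first by rewrite /reduced /= ne.
by move=> f g A hA x; rewrite !wact_cons -(hw' _ _ _ hA).
Qed.

(** * Words acting on finite partial isomorphisms *)

Definition swap (a : rat * rat) := (a.2, a.1).

Definition lgraph (p q : seq (rat * rat)) (l : letter) : seq (rat * rat) :=
  let r := if l.1 then q else p in if l.2 then map swap r else r.

Lemma mem_swap p (a : rat * rat) : (a \in map swap p) = (swap a \in p).
Proof.
rewrite -{1}(_ : swap (swap a) = a); last by case: a.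
by rewrite mem_map // => -[x y] [x' y'] [-> ->].
Qed.

Lemma map_swapK p : map swap (map swap p) = p.
Proof. by rewrite -map_comp map_id_in // => -[]. Qed.

Lemma partial_iso_swap p : partial_iso p -> partial_iso (map swap p).
Proof. by move=> hp a b; rewrite !mem_swap => ap bp; case: (hp _ _ ap bp). Qed.

Lemma lgraph_act p q f g A l x y : represents f g A ->
  Ubasic p f -> Ubasic q g -> (x, y) \in lgraph p q l -> A l x = y.
Proof.
move=> hA [_ hp] [_ hq].
case: l => -[] [] /=; rewrite /lgraph /= ?mem_swap /swap /=.
- by move=> /hq /= <-; rewrite -(rep_g hA) (rep_K hA (true, false)).
- by move=> /hq /= <-; rewrite (rep_g hA).
- by move=> /hp /= <-; rewrite -(rep_f hA) (rep_K hA (false, false)).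
- by move=> /hp /= <-; rewrite (rep_f hA).
Qed.

Fixpoint wdef p q (w : seq letter) (x : rat) : Prop :=
  if w is l :: w' then exists2 y, (x, y) \in lgraph p q l & wdef p q w' y else True.

Lemma wdef_cat p q f g A w w' x : represents f g A ->
  Ubasic p f -> Ubasic q g -> wdef p q (w ++ w') x ->
  wdef p q w x /\ wdef p q w' (wact A w x).
Proof.
move=> hA hp hq; elim: w x => //= l w IH x [y xy /IH[h1 h2]].
by split; [exists y | rewrite wact_cons (lgraph_act hA hp hq xy)].
Qed.

(* A long power can only be read inside a finite partial isomorphism at a
   fixed point, since all other orbits are strictly monotone. *)
Lemma wdef_nseq p q f g A l n x : represents f g A ->
  Ubasic p f -> Ubasic q g -> (size (lgraph p q l) < n)%N ->
  wdef p q (nseq n l) x -> A l x = x.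
Proof.
move=> hA hp hq sn hw.
have hl := letter_aut hA l.
have dom i : (i < n)%N -> iter i (A l) x \in map fst (lgraph p q l).
  move: hw; clear sn; elim: i n x => [|i IH] [|n] x //= [y xy hy] h.
    exact: (map_f fst xy).
  rewrite -iterS iterSr (lgraph_act hA hp hq xy).
  exact: (IH _ _ hy h).
have [//|nx] := eqVneq (A l x) x.
have inj : injective (fun i => iter i (A l) x).
  suff ne i j : (i < j)%N -> iter i (A l) x <> iter j (A l) x.
    by move=> i j e; case: (ltngtP i j) => // /ne; rewrite e.
  elim: i j => [|i IH] [|j] // ij; last by rewrite !iterS => /(aut_inj hl); exact: IH.
  move: nx; rewrite neq_lt => /orP[] lx e.
  - suff : iter j.+1 (A l) x < x by rewrite -e ltxx.
    by elim: j {ij e} => // m IHm; apply: lt_trans lx; rewrite iterS aut_lt.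
  - suff : x < iter j.+1 (A l) x by rewrite -e ltxx.
    by elim: j {ij e} => // m IHm; apply: (lt_trans lx); rewrite iterS aut_lt.
have U : uniq [seq iter i (A l) x | i <- iota 0 n] by rewrite map_inj_uniq ?iota_uniq.
(* Pigeonhole: [n] distinct iterates would lie in a domain of fewer than [n] points. *)
have := @uniq_leq_size _ _ (map fst (lgraph p q l)) U.
rewrite !size_map size_iota leqNgt sn => H; suff : false by [].
apply: H => y /mapP[i]; rewrite mem_iota => /andP[_ /dom ?] -> //.
Qed.

(** Any point slightly to the right of [f x], for an extension [f] of [p], is an admissible value;
    the gap also avoids [s]. *)
Lemma partial_iso_fresh p (s : seq rat) x : partial_iso p -> x \notin map fst p ->
  exists2 y, y \notin s & partial_iso ((x, y) :: p).
Proof.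
move=> hp xp; have [f [hf fp]] := partial_iso_extend hp.
have [y fy hy] := right_gap (s ++ map snd p) (f x).
exists y.
  apply/negP => ys; have := hy y; rewrite mem_cat ys => /(_ isT)[]; last by rewrite ltxx.
  by rewrite leNgt fy.
apply: partial_iso_cons => // a ap.
have ne : a.1 != x by apply: contra xp => /eqP <-; exact: map_f.
have := hy a.2; rewrite mem_cat map_f ?orbT // => /(_ isT).
have e1 : (a.1 < x) = (a.2 < f x) by rewrite -(fp _ ap) aut_lt.
have e2 : (x < a.1) = (f x < a.2) by rewrite -(fp _ ap) aut_lt.
have ne2 : a.2 != f x by rewrite -(fp _ ap) (inj_eq (aut_inj hf)).
rewrite e1 e2; move: ne2; case: ltgtP => // h _ [] h'; split; lra.
Qed.

(* Once a reduced word leaves the domain of [(p, q)], every further letter acts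
   on a new point, so its value can be chosen freely. *)
Lemma free_extension p q (s : seq rat) w x : partial_iso p -> partial_iso q ->
  reduced w -> ~ wdef p q w x ->
  exists f g, [/\ Ubasic p f, Ubasic q g &
    forall A, represents f g A -> wact A w x \notin s].
Proof.
elim: w p q x => [|l w IH] p q x hp hq rw nd; first by case: nd.
have rw' : reduced w := path_sorted rw.
have [/mapP[[x' y] /= xy xx']|xl] := boolP (x \in map fst (lgraph p q l)).
  subst x'.
  have [|f [g [fp gq H]]] := IH p q y hp hq rw'.
    by move=> h; apply: nd; exists y.
  exists f, g; split=> // A hA; rewrite wact_cons (lgraph_act hA fp gq xy).
  exact: H.
have hl : partial_iso (lgraph p q l).
  by case: l {rw nd xl} => -[] []; rewrite /lgraph /=; try apply: partial_iso_swap.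
(* The new value must avoid [s], in case this is the last letter, and every point already in use, so
   that the next letter again starts outside the domain. *)
pose s' := x :: s ++ map fst p ++ map snd p ++ map fst q ++ map snd q.
have [y ys' hy] := partial_iso_fresh s' hl xl.
move: ys'; rewrite !inE !mem_cat !negb_or.
move=> /andP[yx /andP[ys /andP[y1 /andP[y2 /andP[y3 y4]]]]].
pose a := if l.2 then (y, x) else (x, y).
pose p' := if l.1 then p else a :: p; pose q' := if l.1 then a :: q else q.
have hp' : partial_iso p'.
  rewrite /p' /a; case: l {rw nd xl hl p' q' a} hy => -[] [] //= /partial_iso_swap.
  by rewrite /lgraph /= map_swapK.
have hq' : partial_iso q'.
  rewrite /q' /a; case: l {rw nd xl hl hp' p' q' a} hy => -[] [] //= /partial_iso_swap.
  by rewrite /lgraph /= map_swapK.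
have xy : (x, y) \in lgraph p' q' l.
  by rewrite /p' /q' /a /lgraph; case: l {rw nd xl hl hy hp' hq' p' q' a} => -[] [] /=;
     rewrite ?mem_swap ?mem_head ?inE ?eqxx.
have sub f g : Ubasic p' f /\ Ubasic q' g -> Ubasic p f /\ Ubasic q g.
  by rewrite /p' /q'; case: l.1 => -[h1 h2]; split=> //;
    [case/Ubasic_cons: h2 | case/Ubasic_cons: h1].
case: w IH rw rw' {nd} => [|l' w] IH rw rw'.
  have [f fp] := partial_iso_extend hp'; have [g gq] := partial_iso_extend hq'.
  have [] := sub f g => // h1 h2.
  by exists f, g; split=> // A hA; rewrite wact_cons (lgraph_act hA fp gq xy).
have [|f [g [fp gq H]]] := IH p' q' y hp' hq' rw'.
  (* The fresh point [y] occurs only in the new pair, and only [linv l] could read that pair from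
     [y]. *)
  have nl : l' != linv l by case/andP: rw.
  move=> /= [z yz _]; move: yz nl; rewrite /lgraph /p' /q' /a.
  have n1 r (z' : rat) : y \notin map fst r -> ((y, z') \in r) = false.
    by move=> h; apply: contraNF h => h; exact: (map_f fst h).
  have n2 r (z' : rat) : y \notin map snd r -> ((z', y) \in r) = false.
    by move=> h; apply: contraNF h => h; exact: (map_f snd h).
  case: l {rw xl hl hy xy sub hp' hq' p' q' a} => -[] [] /=; case: l' {rw' IH} => -[] [] /=;
    rewrite ?mem_swap /swap /= ?inE ?xpair_eqE ?(negbTE yx) ?andbF ?n1 ?n2 //= -map_comp //.
have [] := sub f g => // h1 h2.
by exists f, g; split=> // A hA; rewrite wact_cons (lgraph_act hA fp gq xy) H.
Qed.

(** Computing the word on [s] consults finitely many values of the generators, those along the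
    orbits; [p] and [q] record them. *)
Lemma wact_locally_constant f g A w (s : seq rat) : represents f g A ->
  exists p q, [/\ Ubasic p f, Ubasic q g &
    forall f' g' A', represents f' g' A' -> Ubasic p f' -> Ubasic q g' ->
      {in s, wact A' w =1 wact A w}].
Proof.
move=> hA; have [hf hg _ _ _] := hA.
elim: s => [|x s [p [q [fp gq H]]]]; first by exists [::], [::]; split.
suff [p' [q' [fp' gq' H']]] : exists p q, [/\ Ubasic p f, Ubasic q g &
    forall f' g' A', represents f' g' A' -> Ubasic p f' -> Ubasic q g' ->
      wact A' w x = wact A w x].
  exists (p ++ p'), (q ++ q'); split; try exact/Ubasic_cat.
  move=> f' g' A' hA' /Ubasic_cat[h1 h2] /Ubasic_cat[h3 h4] y.
  rewrite inE => /predU1P[->|]; first exact: (H' _ _ _ hA' h2 h4).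
  exact: (H _ _ _ hA' h1 h3).
elim: w x {H p q fp gq} => [|l w IH] x; first by exists [::], [::]; split.
have [p [q [fp gq H]]] := IH (A l x).
pose a := if l.2 then (A l x, x) else (x, A l x).
pose p' := if l.1 then p else a :: p; pose q' := if l.1 then a :: q else q.
have xy : (x, A l x) \in lgraph p' q' l.
  by rewrite /p' /q' /a /lgraph; case: l {p' q' a H IH fp gq} => -[] [] /=;
     rewrite ?mem_swap ?mem_head ?inE ?eqxx.
have sub f' g' : Ubasic p' f' /\ Ubasic q' g' -> Ubasic p f' /\ Ubasic q g'.
  by rewrite /p' /q'; case: l.1 => -[h1 h2]; split=> //;
    [case/Ubasic_cons: h2 | case/Ubasic_cons: h1].
exists p', q'; split.
- rewrite /p'; case e : (l.1) => //; apply/Ubasic_cons; split=> //.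
  rewrite /a; case e' : (l.2) => /=; rewrite -(rep_f hA).
    have -> : l = linv (false, false) by rewrite (surjective_pairing l) e e'.
    exact: (rep_VK hA).
  by rewrite (surjective_pairing l) e e'.
- rewrite /q'; case e : (l.1) => //; apply/Ubasic_cons; split=> //.
  rewrite /a; case e' : (l.2) => /=; rewrite -(rep_g hA).
    have -> : l = linv (true, false) by rewrite (surjective_pairing l) e e'.
    exact: (rep_VK hA).
  by rewrite (surjective_pairing l) e e'.
move=> f' g' A' hA' h1 h2; have [] := sub f' g' => // h3 h4.
by rewrite !wact_cons (lgraph_act hA' h1 h2 xy) (H _ _ _ hA').
Qed.

(** * Ladders *)

(** Near either end of the ladders built below, one generator is the identity and the other moves
    points up; one positive letter of each kind works whichever is which. *)
Definition lift_word : seq letter := [:: (false, false); (true, false)].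

(* A ladder describes an interval ([region]) invariant under the action: any
   letter costs at most one rung, near the bottom as well as near the top, and
   [lift_word] regains one.  The word [climb] leads from the zeroth bottom rung
   to the top part, where one generator is the identity. *)
Record ladder (A : letter -> rat -> rat) := Ladder {
  region : rat -> Prop;
  bot : nat -> rat -> Prop;
  top : nat -> rat -> Prop;
  climb : seq letter;
  region_letter : forall l t, region t -> region (A l t);
  bot_region : forall n t, bot n t -> region t;
  top_region : forall n t, top n t -> region t;
  bot_letter : forall n l t, bot n t -> bot n.+1 (A l t);
  bot_lift : forall n t, bot n.+1 t -> bot n (wact A lift_word t);
  bot0_lift : forall t, bot 0 t -> bot 0 (wact A lift_word t);
  top_letter : forall n l t, top n.+1 t -> top n (A l t);
  top_lift : forall n t, top n t -> top n.+1 (wact A lift_word t);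
  top_down : forall n t, top n.+1 t -> top n t;
  climbP : forall t, bot 0 t -> top 0 (wact A climb t);
  top_gen : exists i, forall t, top 0 t ->
    (forall e, A (i, e) t = t) /\ top 0 (A (~~ i, false) t) }.

(** A ladder looks at the action only on its region, which is invariant. This lets ladders survive
    gluing. *)
Lemma ladder_transfer A A' (L : ladder A) :
  (forall l t, region L t -> A' l t = A l t) ->
  exists L' : ladder A', bot L' = bot L /\ region L' = region L.
Proof.
move=> E.
have EW w t : region L t -> wact A' w t = wact A w t.
  elim: w t => //= l w IH t ht; rewrite !wact_cons E // IH //.
  exact: region_letter.
unshelve eexists (@Ladder A' (region L) (bot L) (top L) (climb L)
  _ _ _ _ _ _ _ _ _ _ _); last by [].
- by move=> l t ht; rewrite E //; apply: region_letter.
- exact: bot_region.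
- exact: top_region.
- by move=> n l t ht; have rt := bot_region ht; rewrite E //; apply: bot_letter.
- by move=> n t ht; have rt := bot_region ht; rewrite EW //; apply: bot_lift.
- by move=> t ht; have rt := bot_region ht; rewrite EW //; apply: bot0_lift.
- by move=> n l t ht; have rt := top_region ht; rewrite E //; apply: top_letter.
- by move=> n t ht; have rt := top_region ht; rewrite EW //; apply: top_lift.
- exact: top_down.
- by move=> t ht; have rt := bot_region ht; rewrite EW //; apply: climbP.
- have [i hi] := top_gen L; exists i => t ht; have [h1 h2] := hi t ht.
  have rt := top_region ht.
  by split=> [e|]; rewrite E.
Qed.

Section Push.
Variable A : letter -> rat -> rat.

Lemma bot_word (L : ladder A) w n t : bot L n t -> bot L (n + size w) (wact A w t).
Proof.
elim: w n t => [|l w IH] n t h; first by rewrite addn0.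
by rewrite wact_cons /= -addSnnS; apply: IH; apply: bot_letter.
Qed.

Lemma top_word (L : ladder A) w n t : top L (n + size w) t -> top L n (wact A w t).
Proof.
elim: w n t => [|l w IH] n t; first by rewrite addn0.
by rewrite /= addnS => h; rewrite wact_cons; apply: IH; apply: top_letter.
Qed.

Definition lifts n := flatten (nseq n lift_word).

Lemma wact_liftsS n t : wact A (lifts n.+1) t = wact A (lifts n) (wact A lift_word t).
Proof. by []. Qed.

Lemma bot_lifts (L : ladder A) n t : bot L n t -> bot L 0 (wact A (lifts n) t).
Proof. by elim: n t => // n IH t h; rewrite wact_liftsS; apply/IH/bot_lift. Qed.

Lemma bot0_lifts (L : ladder A) n t : bot L 0 t -> bot L 0 (wact A (lifts n) t).
Proof. by elim: n t => // n IH t h; rewrite wact_liftsS; apply/IH/bot0_lift. Qed.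

Lemma top_lifts (L : ladder A) n m t : top L m t -> top L (m + n) (wact A (lifts n) t).
Proof.
elim: n m t => [|n IH] m t h; first by rewrite addn0.
by rewrite wact_liftsS -addSnnS; apply/IH/top_lift.
Qed.

Lemma top_downs (L : ladder A) n t : top L n t -> top L 0 t.
Proof. by elim: n => // n IH /top_down. Qed.

(* The points are brought to the top one after the other; lifting before the
   climb of a point keeps those already at the top in place, lifting afterwards
   brings those still to be treated back to the zeroth bottom rung. *)
Lemma push_up (todo placed : seq (ladder A * rat)) v :
  (forall L t, List.In (L, t) placed -> top L 0 (wact A v t)) ->
  (forall L t, List.In (L, t) todo -> bot L 0 (wact A v t)) ->
  exists u, forall L t, List.In (L, t) placed \/ List.In (L, t) todo ->
    top L 0 (wact A u t).
Proof.
elim: todo placed v => [|[L0 t0] todo IH] dn v hd ht.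
  by exists v => L t [/hd|].
(* Each letter costs at most one rung, so [n] bounds what the climb of [L0] costs the other
   points. *)
pose n := size (climb L0); pose c := lifts n ++ climb L0 ++ lifts n.
have hc t : wact A (v ++ c) t =
    wact A (lifts n) (wact A (climb L0) (wact A (lifts n) (wact A v t))).
  by rewrite !wact_cat.
have [||u hu] := IH ((L0, t0) :: dn) (v ++ c).
- move=> L t [[<- <-]|/hd h]; rewrite hc; apply: (@top_downs _ n);
    rewrite -[n]add0n; apply: top_lifts.
    by apply: climbP; apply: bot0_lifts; apply: ht; left.
  by apply: top_word; apply: top_lifts.
- move=> L t h; rewrite hc; apply: bot_lifts; rewrite -[n]add0n; apply: bot_word.
  by apply: bot0_lifts; apply: ht; right.
by exists u => L t [h|[h|h]]; apply: hu; [left; right | left; left | right].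
Qed.

End Push.

(** * Construction of ladders *)

Section BuildLadder.
Variables (f g : rat -> rat) (A : letter -> rat -> rat).
Hypothesis hA : represents f g A.
Variables (r r' beta mu : rat) (i j : bool) (V : seq letter).
Hypotheses (fr : forall l, A l r = r) (fr' : forall l, A l r' = r').
Hypothesis (rb : r < beta).
Hypothesis (bfix : forall e t, t <= beta -> A (i, e) t = t).
Hypothesis (bup : beta < A (~~ i, false) beta).
Hypothesis (tfix : forall e t, mu <= t -> A (j, e) t = t).
Hypothesis (tup : mu < A (~~ j, false) mu).
Hypothesis (climbV : forall t, beta <= t -> mu <= wact A V t).

Let le l := aut_le (letter_aut hA l).
Let lt l := aut_lt (letter_aut hA l).

Let reg t := r < t < r'.
Let y := A (~~ i, true).
Let rung n := iter n y beta.
Let step n := iter n (A (~~ j, false)) mu.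

Let reg_letter l t : reg t -> reg (A l t).
Proof. by rewrite /reg -{2}(fr l) -{2}(fr' l) !lt. Qed.

Let reg_word w t : reg t -> reg (wact A w t).
Proof. by elim: w t => // l w IH t h; rewrite wact_cons; apply/IH/reg_letter. Qed.

Let rungS n : rung n.+1 <= rung n.
Proof.
rewrite /rung; elim: n => [|n IH]; last by rewrite !iterS le.
by rewrite /= /y -(le (~~ i, false)) (rep_VK hA (~~ i, false)) ltW.
Qed.

Let rung_le n : rung n <= beta.
Proof. by elim: n => // n; apply: le_trans (rungS n). Qed.

Let stepS n : step n <= step n.+1.
Proof. by rewrite /step; elim: n => [|n IH] /=; [exact: ltW | rewrite le]. Qed.

Let step_ge n : mu <= step n.
Proof. by elim: n => // n h; apply: le_trans (stepS n). Qed.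

Let bX n e t : rung n <= t -> rung n <= A (i, e) t.
Proof.
move=> h; case: (leP t beta) => tb; first by rewrite bfix.
by apply: (le_trans (rung_le n)); rewrite -(bfix e (lexx beta)) le ltW.
Qed.

Let bY n t : rung n.+1 <= t -> rung n <= A (~~ i, false) t.
Proof. by rewrite -(le (~~ i, false)) /rung iterS (rep_VK hA (~~ i, false)). Qed.

Let bY' n t : rung n <= t -> rung n <= A (~~ i, false) t.
Proof. by move=> h; apply: bY; apply: le_trans h. Qed.

Let bYi n t : rung n <= t -> rung n.+1 <= A (~~ i, true) t.
Proof. by move=> h; rewrite /rung iterS le. Qed.

Let tX n e t : step n <= t -> A (j, e) t = t.
Proof. by move=> h; apply: tfix; apply: le_trans h. Qed.

Let tY n t : step n <= t -> step n.+1 <= A (~~ j, false) t.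
Proof. by move=> h; rewrite /step iterS le. Qed.

Let tYi n t : step n.+1 <= t -> step n <= A (~~ j, true) t.
Proof. by rewrite -(le (~~ j, true)) /step iterS (rep_K hA (~~ j, false)). Qed.

(** Bottom rungs are the iterated preimages of [beta] under the generator [~~ i], top rungs the
    iterated images of [mu] under [~~ j]. Letters in [i] fix the points up to [beta] and keep the
    others above it, so only the inverse of [~~ i] loses a bottom rung, and its positive letter
    regains one. Above [mu] the letters in [j] do nothing and those in [~~ j] shift by one rung. *)
Lemma build_ladder : exists L : ladder A,
  (forall t, beta <= t < r' -> bot L 0 t) /\ (forall t, region L t -> r < t < r').
Proof.
have caseb k b : k = b \/ k = ~~ b by case: k; case: b; [left|right|right|left].
unshelve eexists (@Ladder A reg (fun n t => reg t /\ rung n <= t)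
  (fun n t => reg t /\ step n <= t) V _ _ _ _ _ _ _ _ _ _ _).
- exact: reg_letter.
- by move=> n t [].
- by move=> n t [].
- move=> n [k e] t [h1 h2]; split; first exact: reg_letter.
  case: (caseb k i) => ->; first by apply: (le_trans (rungS n)); exact: bX.
  by case: e; [exact: bYi | apply: (le_trans (rungS n)); exact: bY'].
- move=> n t [h1 h2]; split; first exact: reg_word.
  rewrite /lift_word !wact_cons; move: bX bY; clear -h2; case: i => bX bY.
    by apply: bX; apply: bY.
  by apply: bY; apply: bX.
- move=> t [h1 h2]; split; first exact: reg_word.
  rewrite /lift_word !wact_cons; move: bX bY'; clear -h2; case: i => bX bY'.
    by apply: bX; apply: bY'.
  by apply: bY'; apply: bX.
- move=> n [k e] t [h1 h2]; split; first exact: reg_letter.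
  case: (caseb k j) => ->; first by rewrite (tX _ h2); apply: le_trans (stepS n) h2.
  case: e; first exact: tYi.
  by apply: le_trans (tY h2); apply: le_trans (stepS _).
- move=> n t [h1 h2]; split; first exact: reg_word.
  rewrite /lift_word !wact_cons; move: tX tY; clear -h2; case: j => tX tY.
    by rewrite (@tX n.+1); apply: tY.
  by rewrite (@tX n) //; apply: tY.
- by move=> n t [h1 h2]; split=> //; apply: le_trans h2.
- by move=> t [h1 h2]; split; [exact: reg_word | exact: climbV].
- exists j => t [h1 h2]; split=> [e|]; first exact: (tX _ h2).
  by split; [exact: reg_letter | apply: le_trans (tY h2); exact: stepS].
split=> //= t /andP[h1 h2]; split=> //; rewrite /reg h2 andbT.
exact: lt_le_trans h1.
Qed.

End BuildLadder.

(** * Extending a pair around one block *)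

Lemma partial_iso_below p x y : partial_iso p ->
  (forall a, a \in p -> x < a.1 /\ y < a.2) -> partial_iso ((x, y) :: p).
Proof.
move=> hp h; apply: partial_iso_cons => // a /h[h1 h2].
by rewrite h1 h2 !ltNge !ltW.
Qed.

Lemma partial_iso_above p x y : partial_iso p ->
  (forall a, a \in p -> a.1 < x /\ a.2 < y) -> partial_iso ((x, y) :: p).
Proof.
move=> hp h; apply: partial_iso_cons => // a /h[h1 h2].
by rewrite h1 h2 !ltNge !ltW.
Qed.

Definition within (p : seq (rat * rat)) (lo hi : rat) :=
  forall a, a \in p -> lo <= a.1 <= hi /\ lo <= a.2 <= hi.

Lemma within_cons p lo hi x y : lo <= x <= hi -> lo <= y <= hi ->
  within p lo hi -> within ((x, y) :: p) lo hi.
Proof. by move=> hx hy h a; rewrite inE => /predU1P[->|/h]. Qed.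

Lemma within_sub p lo hi lo' hi' : lo' <= lo -> hi <= hi' ->
  within p lo hi -> within p lo' hi'.
Proof. by move=> h1 h2 h a /h[/andP[? ?] /andP[? ?]]; split; lra. Qed.

(** [X] marks the generator that becomes the identity below [beta]; the other one sends [beta] to
    [b]. The marked one links [b] and [s]: as [p] already has an arc from [s] upwards, [s] is free
    on the opposite side of that arc, which decides between [(b, s)] and [(s, b)]. *)
Lemma extend_bottom p (s t beta b : rat) (X : bool) :
  partial_iso p -> within p s t -> beta < b -> b < s -> s < t ->
  (X -> exists2 e, s < e & (s, e) \in p \/ (e, s) \in p) ->
  exists p', [/\ partial_iso p', {subset p <= p'}, within p' beta t &
    if X then (beta, beta) \in p' /\ ((b, s) \in p' \/ (s, b) \in p')
    else (beta, b) \in p'].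
Proof.
move=> hp wp h1 h2 h3; case: X => hX; last first.
  exists ((beta, b) :: p); split; last exact: mem_head.
  - by apply: partial_iso_below => // a /wp[/andP[? ?] /andP[? ?]]; split; lra.
  - by move=> a ap; rewrite inE ap orbT.
  - by apply: within_cons; [lra|lra|apply: within_sub wp; lra].
have {hX} [//|e se hse] := hX.
suff [a [ha ia wa]] : exists a, [/\ a = (b, s) \/ a = (s, b),
    partial_iso (a :: p) & within (a :: p) b t].
  exists ((beta, beta) :: a :: p); split.
  - apply: partial_iso_below => // c /wa[/andP[? ?] /andP[? ?]]; split; lra.
  - by move=> c cp; rewrite !inE cp !orbT.
  - by apply: within_cons; [lra|lra|apply: within_sub wa; lra].
  - by rewrite mem_head !inE; case: ha => ->; rewrite eqxx ?orbT; split; auto.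
have ne a : a \in p -> (s, e) \in p -> s < a.2.
  move=> ap sp; have [/andP[? ?] /andP[? ?]] := wp _ ap.
  by have [_ /= h] := hp _ _ ap sp; lra.
have ne' a : a \in p -> (e, s) \in p -> s < a.1.
  move=> ap sp; have [/andP[? ?] /andP[? ?]] := wp _ ap.
  by have [_ /= h] := hp _ _ ap sp; lra.
case: hse => hse; [exists (b, s) | exists (s, b)]; split; auto.
- apply: partial_iso_below => // a ap; split; last exact: ne.
  by have [/andP[? ?] _] := wp _ ap; lra.
- by apply: within_cons; [lra|lra|apply: within_sub wp; lra].
- apply: partial_iso_below => // a ap; split; first exact: ne'.
  by have [_ /andP[? ?]] := wp _ ap; lra.
- by apply: within_cons; [lra|lra|apply: within_sub wp; lra].
Qed.

(** Mirror image of [extend_bottom]: the marked generator links [t] and [tau] and fixes [mu], the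
    other one sends [tau] to [mu]. *)
Lemma extend_top p (beta t tau mu : rat) (X : bool) :
  partial_iso p -> within p beta t -> beta < t -> t < tau -> tau < mu ->
  (X -> exists2 c, c < t & (c, t) \in p \/ (t, c) \in p) ->
  exists p', [/\ partial_iso p', {subset p <= p'}, within p' beta mu &
    if X then (mu, mu) \in p' /\ ((t, tau) \in p' \/ (tau, t) \in p')
    else (tau, mu) \in p'].
Proof.
move=> hp wp h1 h2 h3; case: X => hX; last first.
  exists ((tau, mu) :: p); split; last exact: mem_head.
  - by apply: partial_iso_above => // a /wp[/andP[? ?] /andP[? ?]]; split; lra.
  - by move=> a ap; rewrite inE ap orbT.
  - by apply: within_cons; [lra|lra|apply: within_sub wp; lra].
have {hX} [//|e se hse] := hX.
suff [a [ha ia wa]] : exists a, [/\ a = (t, tau) \/ a = (tau, t),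
    partial_iso (a :: p) & within (a :: p) beta tau].
  exists ((mu, mu) :: a :: p); split.
  - apply: partial_iso_above => // c /wa[/andP[? ?] /andP[? ?]]; split; lra.
  - by move=> c cp; rewrite !inE cp !orbT.
  - by apply: within_cons; [lra|lra|apply: within_sub wa; lra].
  - by rewrite mem_head !inE; case: ha => ->; rewrite eqxx ?orbT; split; auto.
have ne a : a \in p -> (t, e) \in p -> a.2 < t.
  move=> ap sp; have [/andP[? ?] /andP[? ?]] := wp _ ap.
  by have [_ /= h] := hp _ _ sp ap; lra.
have ne' a : a \in p -> (e, t) \in p -> a.1 < t.
  move=> ap sp; have [/andP[? ?] /andP[? ?]] := wp _ ap.
  by have [_ /= h] := hp _ _ sp ap; lra.
case: hse => hse; [exists (t, tau) | exists (tau, t)]; split; auto.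
- apply: partial_iso_above => // a ap; split; first exact: ne'.
  by have [_ /andP[? ?]] := wp _ ap; lra.
- by apply: within_cons; [lra|lra|apply: within_sub wp; lra].
- apply: partial_iso_above => // a ap; split; last exact: ne.
  by have [/andP[? ?] _] := wp _ ap; lra.
- by apply: within_cons; [lra|lra|apply: within_sub wp; lra].
Qed.

Lemma block_generator p (r beta b s t tau mu r' : rat) (X X' : bool) :
  partial_iso p -> within p s t ->
  r < beta -> beta < b -> b < s -> s < t -> t < tau -> tau < mu -> mu < r' ->
  (X -> exists2 e, s < e & (s, e) \in p \/ (e, s) \in p) ->
  (X' -> exists2 c, c < t & (c, t) \in p \/ (t, c) \in p) ->
  exists f, [/\ Ubasic p f, forall x, x <= r \/ r' <= x -> f x = x,
    if X then (forall x, x <= beta -> f x = x) /\ (f b = s \/ f s = b)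
    else f beta = b &
    if X' then (forall x, mu <= x -> f x = x) /\ (f t = tau \/ f tau = t)
    else f tau = mu].
Proof.
move=> hp wp h1 h2 h3 h4 h5 h6 h7 hX hX'.
have [p1 [i1 s1 w1 m1]] := extend_bottom hp wp h2 h3 h4 hX.
have h8 : beta < t by lra.
have [|p2 [i2 s2 w2 m2]] := @extend_top p1 beta t tau mu X' i1 w1 h8 h5 h6.
  by move=> /hX'[c ct h]; exists c => //; case: h => /s1; auto.
have i3 : partial_iso ((r, r) :: p2).
  by apply: partial_iso_below => // a /w2[/andP[? ?] /andP[? ?]]; split; lra.
have [|f0 F] := @partial_iso_extend ((r', r') :: (r, r) :: p2).
  apply: partial_iso_above => // a; rewrite inE => /predU1P[->/=|]; first by split; lra.
  by move=> /w2[/andP[? ?] /andP[? ?]]; split; lra.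
have [hf0 _] := F.
have {F} [/= fr' /Ubasic_cons[/= fr F]] := (Ubasic_cons _ _ _).1 F.
have mem a : a \in p2 -> f0 a.1 = a.2 by case: F => _; apply.
(* Outside [[c, c']] the extension is replaced by the identity; both ends are fixed points of [f0],
   so the pieces glue. *)
pose c := if X then beta else r; pose c' := if X' then mu else r'.
have f0c : f0 c = c.
  by rewrite /c; case: X m1 {hX c} => // -[/s2/mem].
have f0c' : f0 c' = c'.
  by rewrite /c'; case: X' m2 {hX' c'} => // -[/mem].
have cb : c <= beta by rewrite /c; case: ifP => _; lra.
have cm : mu <= c' by rewrite /c'; case: ifP => _; lra.
pose f x := if x <= c then x else if x <= c' then f0 x else x.
have fE x : c <= x <= c' -> f x = f0 x.
  move=> /andP[cx xc]; rewrite /f xc; case: (leP x c) => // xc'.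
  by have -> : x = c by lra.
exists f; split.
- split.
    have h := glue_aut hf0 id_aut f0c'.
    apply: (glue_aut id_aut h) => /=.
    by rewrite (_ : c <= c') ?f0c //; lra.
  move=> a ap; have [/andP[? ?] /andP[? ?]] := wp _ ap.
  by rewrite fE ?mem //; [apply: s2; apply: s1 | lra].
- move=> x hx; rewrite /f; case: (leP x c) => // xc; case: (leP x c') => // xc'.
  have ? : r <= c by rewrite /c; case: ifP => _; lra.
  have ? : c' <= r' by rewrite /c'; case: ifP => _; lra.
  by have -> : x = c'; [case: hx; lra | rewrite f0c'].
- case: X m1 {hX} @c cb f0c @f fE => /= [[mb mbs] cb f0c fE|mb cb f0c fE].
    split; first by move=> x ->.
    by case: mbs => /s2/mem /= h; [left|right]; rewrite fE ?h //; lra.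
  by rewrite fE ?(mem _ (s2 _ mb)) //; lra.
- case: X' m2 {hX'} @c' cm f0c' @f fE => /= [[mb mbs] cm f0c' fE|mb cm f0c' fE].
    split; last by case: mbs => /mem /= h; [left|right]; rewrite fE ?h //; lra.
    move=> x mx; case: (leP x c) => // _; case: (leP x mu) => // mx'.
    by have -> : x = mu; [lra | rewrite f0c'].
  by rewrite fE ?(mem _ mb) //; lra.
Qed.

(** Induction on the number of points of [S] above [c]: one letter carries everything from [c]
    upwards to or beyond a larger point [c'] of [S]. *)
Lemma climb_arcs f g A (S : seq rat) (s t : rat) : represents f g A ->
  (forall c, c \in S -> s <= c < t ->
     exists l c', [/\ c' \in S, c < c' <= t & c' <= A l c]) ->
  forall c, c \in S -> s <= c <= t ->
  exists v, forall y, c <= y -> t <= wact A v y.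
Proof.
move=> hA H c; move: {2}(count (> c) S) (leqnn (count (> c) S)) => n.
elim: n c => [|n IH] c cn cS /andP[sc ct].
  have [->|ne] := eqVneq c t; first by exists [::].
  have [|l [c' [c'S /andP[cc' _] _]]] := H c cS; first by apply/andP; split; lra.
  move: cn; rewrite leqn0 => /eqP e; suff : has (> c) S by rewrite has_count e.
  by apply/hasP; exists c'.
have [->|ne] := eqVneq c t; first by exists [::].
have [|l [c' [c'S /andP[cc' c't] hl]]] := H c cS; first by apply/andP; split; lra.
have [|||v hv] := IH c' => //; last 2 first.
- by apply/andP; split; lra.
- exists (l :: v) => y cy; rewrite wact_cons; apply: hv; apply: (le_trans hl).
  by rewrite (aut_le (letter_aut hA l)).
rewrite -ltnS; apply: leq_trans cn.
(* The count drops strictly because [c'] lies above [c] but not above itself. *)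
have := count_predC (> c') (filter (> c) S).
rewrite !size_filter !count_filter /= => <-.
have -> : count (predI (> c') (> c)) S = count (> c') S.
  by apply: eq_count => x /=; apply/andP/idP => [[]|h]//; split=> //; lra.
rewrite -[X in (X < _)%N]addn0 ltn_add2l -has_count; apply/hasP; exists c' => //=.
by rewrite ltxx cc'.
Qed.

(** Read in the right direction, such an arc carries [c] to a point beyond [c]; an arc starting at
    [c] itself counts. *)
Definition crosses (c : rat) (a : rat * rat) : bool :=
  (a.1 <= c < a.2) || (a.2 <= c < a.1).

(** Every point of [S] in [[s, t)] is crossed by an arc, so a word leads from [s] to [t]. New arcs
    in the gaps on either side connect this climb to zones where one generator is the identity. *)
Lemma block_ladder p q (S : seq rat) (r s t r' : rat) :
  partial_iso p -> partial_iso q -> within p s t -> within q s t ->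
  r < s -> s < t -> t < r' -> s \in S ->
  (forall a, a \in p ++ q -> a.1 \in S /\ a.2 \in S) ->
  (forall c, c \in S -> s <= c < t -> has (crosses c) (p ++ q)) ->
  exists f g, [/\ Ubasic p f, Ubasic q g,
    forall x, x <= r \/ r' <= x -> f x = x /\ g x = x &
    forall A, represents f g A -> exists L : ladder A,
      (forall a, s <= a <= t -> bot L 0 a) /\
      (forall x, region L x -> r < x < r')].
Proof.
move=> hp hq wp wq rs st tr' sS hS cover.
pose P k := if k then q else p.
have memP a : a \in p ++ q -> exists k, a \in P k.
  by rewrite mem_cat => /orP[]; [exists false | exists true].
have hP k : partial_iso (P k) by case: k.
have wP k : within (P k) s t by case: k.
have PS k a : a \in P k -> a.1 \in S /\ a.2 \in S.
  by move=> ap; apply: hS; rewrite mem_cat; case: k ap => ->; rewrite ?orbT.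
(* The arc crossing [s] must start or end at [s], the least point of the block; its generator
   becomes the identity at the bottom. *)
have [i hi] : exists i, exists2 e, s < e & (s, e) \in P i \/ (e, s) \in P i.
  have [|a /memP[k ak] ca] := hasP (cover s sS _); first by rewrite lexx.
  have [/andP[? ?] /andP[? ?]] := wP _ _ ak.
  exists k; case/orP: ca => /andP[? ?].
    by exists a.2 => //; left; rewrite (_ : s = a.1) -?surjective_pairing //; lra.
  by exists a.1 => //; right; rewrite (_ : s = a.2) -?surjective_pairing //; lra.
(* The arc crossing the largest point of [S] below [t] must reach [t]; its generator becomes the
   identity at the top. *)
have [j hj] : exists j, exists2 e, e < t & (e, t) \in P j \/ (t, e) \in P j.
  have [|c] := @seq_max [seq x <- S | x < t].
    by apply/eqP; rewrite -has_filter; apply/hasP; exists s.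
  rewrite mem_filter => /andP[ct cS] cm.
  have sc : s <= c by apply: cm; rewrite mem_filter st.
  have [|a /memP[k ak] ca] := hasP (cover c cS _); first by rewrite sc ct.
  have [/andP[? ?] /andP[? ?]] := wP _ _ ak.
  have [a1S a2S] := PS _ _ ak.
  have big x : x \in S -> c < x -> t <= x.
    by move=> xS cx; case: (leP t x) => // xt; have := cm x; rewrite mem_filter xt xS; lra.
  exists k; case/orP: ca => /andP[h1 h2].
    have := big _ a2S h2 => h3.
    exists a.1; first lra.
    by left; rewrite (_ : t = a.2) -?surjective_pairing //; lra.
  have := big _ a1S h2 => h3.
  exists a.2; first lra.
  by right; rewrite (_ : t = a.1) -?surjective_pairing //; lra.
(* These points trisect the gaps [(r, s)] and [(t, r')]. *)
pose beta := (2 * r + s) / 3; pose b := (r + 2 * s) / 3.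
pose tau := (2 * t + r') / 3; pose mu := (t + 2 * r') / 3.
have h1 : r < beta by rewrite /beta; lra.
have h2 : beta < b by rewrite /beta /b; lra.
have h3 : b < s by rewrite /b; lra.
have h5 : t < tau by rewrite /tau; lra.
have h6 : tau < mu by rewrite /tau /mu; lra.
have h7 : mu < r' by rewrite /mu; lra.
have G k : exists f, [/\ Ubasic (P k) f, forall x, x <= r \/ r' <= x -> f x = x,
    if k == i then (forall x, x <= beta -> f x = x) /\ (f b = s \/ f s = b)
    else f beta = b &
    if k == j then (forall x, mu <= x -> f x = x) /\ (f t = tau \/ f tau = t)
    else f tau = mu].
  by apply: (@block_generator (P k) r beta b s t tau mu r') => // /eqP ->.
have [f [Pf idf bf tf]] := G false; have [g [Pg idg bg tg]] := G true.
exists f, g; split=> //; first by move=> x hx; rewrite idf ?idg.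
move=> A hA; pose F k := if k then g else f.
have AF k : A (k, false) =1 F k by case: k; [exact: rep_g hA | exact: rep_f hA].
have idF k x : x <= r \/ r' <= x -> F k x = x by case: k; [exact: idg | exact: idf].
have fixV k e x : F k x = x -> A (k, e) x = x.
  move=> h; case: e; last by rewrite AF.
  by rewrite -{1}h -AF; exact: (rep_K hA (k, false)).
have {bf bg} [bX [bs bY]] : (forall x, x <= beta -> F i x = x) /\
    ((F i b = s \/ F i s = b) /\ F (~~ i) beta = b).
  by case: i {hi G} bf bg => /=; [move=> ? []|move=> [? ?]].
have {tf tg} [tX [ts tY]] : (forall x, mu <= x -> F j x = x) /\
    ((F j t = tau \/ F j tau = t) /\ F (~~ j) tau = mu).
  by case: j {hj G} tf tg => /=; [move=> ? []|move=> [? ?]].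
have le l := aut_le (letter_aut hA l).
have lt l := aut_lt (letter_aut hA l).
have [e1 he1] : exists e, A (i, e) b = s.
  case: bs => h; first by exists false; rewrite AF.
  by exists true; rewrite -h -AF; exact: (rep_K hA (i, false)).
have [e2 he2] : exists e, A (j, e) t = tau.
  case: ts => h; first by exists false; rewrite AF.
  by exists true; rewrite -h -AF; exact: (rep_K hA (j, false)).
have [||v hv] := @climb_arcs f g A S s t hA _ s sS.
- move=> c cS hc; have /hasP[a /memP[k ak] ca] := cover c cS hc.
  have [/andP[? ?] /andP[? ?]] := wP _ _ ak.
  have [a1S a2S] := PS _ _ ak.
  have Fa : A (k, false) a.1 = a.2.
    by rewrite AF; case: (k) ak => ak; [case: Pg | case: Pf] => _; apply.
  case/orP: ca => /andP[ca1 ca2].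
    exists (k, false), a.2; split=> //; first lra.
    by rewrite -Fa le.
  exists (k, true), a.1; split=> //; first lra.
  by rewrite -{1}(rep_K hA (k, false) a.1) Fa le.
- by rewrite lexx ltW.
(* The climb: [beta] to [b] by [~~ i], [b] to [s] by [i], [s] to [t] along the arcs, [t] to [tau] by
   [j], [tau] to [mu] by [~~ j]. *)
have [||||||||L [hL1 hL2]] := @build_ladder f g A hA r r' beta mu i j
  ([:: (~~ i, false); (i, e1)] ++ v ++ [:: (j, e2); (~~ j, false)]).
- by move=> [k e]; apply/fixV/idF; left.
- by move=> [k e]; apply/fixV/idF; right.
- by [].
- by move=> e x /bX/fixV.
- by rewrite AF bY.
- by move=> e x /tX/fixV.
- by rewrite -{1}tY -AF lt.
- move=> y by_; rewrite !wact_cat !wact_cons /= AF.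
  have -> : mu = A (~~ j, false) (A (j, e2) t) by rewrite he2 AF tY.
  rewrite -AF !le; apply: hv; rewrite -he1 le -bY -AF le //.
exists L; split=> // a /andP[? ?]; apply: hL1; apply/andP; split; lra.
Qed.

(** For an inverse letter, the agreement is used at the image point, which lies in [P] by
    invariance. *)
Lemma represents_agree f g A f0 g0 A0 (P : rat -> Prop) :
  represents f g A -> represents f0 g0 A0 ->
  (forall l x, P x -> P (A0 l x)) -> (forall x, P x -> f x = f0 x /\ g x = g0 x) ->
  forall l x, P x -> A l x = A0 l x.
Proof.
move=> hA hA0 PA E.
have pos i x : P x -> A (i, false) x = A0 (i, false) x.
  move=> /E[ef eg]; case: i; first by rewrite (rep_g hA) (rep_g hA0).
  by rewrite (rep_f hA) (rep_f hA0).
move=> [i []] x Px; last exact: pos.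
rewrite -{1}(rep_VK hA0 (i, false) x) -pos; last exact: PA.
exact: (rep_K hA (i, false)).
Qed.

Lemma ladder_agree f g A f0 g0 A0 (L : ladder A0) :
  represents f g A -> represents f0 g0 A0 ->
  (forall x, region L x -> f x = f0 x /\ g x = g0 x) ->
  exists L' : ladder A, bot L' = bot L /\ region L' = region L.
Proof.
move=> hA hA0 E; apply: ladder_transfer => l x.
by apply: (represents_agree hA hA0) => //; apply: region_letter.
Qed.

(* The points of [S] split into blocks, the maximal sets connected by arcs
   [(d, e)] of [p ++ q]; blocks are treated from left to right, and the
   automorphisms are the identity between them. *)
Lemma structured_extension n p q (S : seq rat) r : (size S <= n)%N ->
  partial_iso p -> partial_iso q ->
  (forall a, a \in p ++ q -> a.1 \in S /\ a.2 \in S) -> (forall x, x \in S -> r < x) ->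
  exists f g, [/\ Ubasic p f, Ubasic q g,
    forall x, x <= r -> f x = x /\ g x = x &
    forall A, represents f g A -> forall a, a \in S ->
      (f a = a /\ g a = a) \/
      exists L : ladder A, bot L 0 a /\ forall x, region L x -> r < x].
Proof.
elim: n p q S r => [|n IH] p q S r sz hp hq hS rS.
  have S0 : S = [::] by case: S sz {hS rS}.
  exists id, id; subst S; split=> //; split; try exact: id_aut;
    by move=> a ap; have [] := hS a; rewrite ?mem_cat ?ap ?orbT.
have [S0|/eqP S0] := eqVneq S [::].
  by apply: IH; rewrite ?S0 //; subst S.
have [s sS smin] := seq_min S0.
(* The least uncrossed point [t] is the right end of the first block; the maximum of [S] is never
   crossed, so [t] exists. *)
pose T := [seq c <- S | ~~ has (crosses c) (p ++ q)].
have T0 : T <> [::].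
  have [m mS mmax] := seq_max S0.
  apply/eqP; rewrite -has_filter; apply/hasP; exists m => //.
  apply/hasPn => a /hS[/mmax h1 /mmax h2]; rewrite /crosses; lra.
have [t] := seq_min T0; rewrite mem_filter => /andP[/hasPn nt tS] tmin.
have side a : a \in p ++ q -> (a.1 <= t) = (a.2 <= t).
  by move=> /nt; rewrite /crosses; case: (leP a.1 t); case: (leP a.2 t) => //=;
    rewrite ?andbF.
have side_p a : a \in p -> (a.1 <= t) = (a.2 <= t).
  by move=> h; apply: side; rewrite mem_cat h.
have side_q a : a \in q -> (a.1 <= t) = (a.2 <= t).
  by move=> h; apply: side; rewrite mem_cat h orbT.
have S_p a : a \in p -> a.1 \in S /\ a.2 \in S.
  by move=> h; apply: hS; rewrite mem_cat h.
have S_q a : a \in q -> a.1 \in S /\ a.2 \in S.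
  by move=> h; apply: hS; rewrite mem_cat h orbT.
(* [r'] separates the first block from the later ones. *)
have [r' tr' gap] := right_gap S t.
pose S' := [seq x <- S | t < x].
pose hi (l : seq (rat * rat)) := [seq a <- l | t < a.1].
pose lo (l : seq (rat * rat)) := [seq a <- l | a.1 <= t].
have isoF (P : pred (rat * rat)) l : partial_iso l -> partial_iso (filter P l).
  by apply: partial_iso_sub => a; rewrite mem_filter => /andP[].
have [|||||f' [g' [pf' qg' id' H']]] := IH (hi p) (hi q) S' r'.
- rewrite -ltnS; apply: leq_trans sz; rewrite size_filter -(count_predC (> t) S).
  rewrite -[X in (X < _)%N]addn0 ltn_add2l -has_count.
  by apply/hasP; exists t => //=; rewrite ltxx.
- exact: isoF.
- exact: isoF.
- move=> a; rewrite -filter_cat mem_filter => /andP[ta aa].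
  have [a1 a2] := hS _ aa; rewrite !mem_filter ta a1 a2.
  by move: ta; rewrite !ltNge side // => ->.
- by move=> x; rewrite mem_filter => /andP[tx /gap[]//]; lra.
have rs := rS _ sS.
have st : s <= t := smin _ tS.
(* A one-point block carries at most the pair [(t, t)]; the extension of the later blocks already
   fixes [t]. *)
have [ets|nst] := eqVneq s t.
  have fixt x : x \in S -> x <= t -> x = t by move=> /smin; lra.
  have ext l h : (forall a, a \in l -> (a.1 <= t) = (a.2 <= t)) ->
      (forall a, a \in l -> a.1 \in S /\ a.2 \in S) ->
      h t = t -> Ubasic (hi l) h -> Ubasic l h.
    move=> sl Sl ht [hh hl]; split=> // a al.
    have [a1 a2] := Sl _ al; have [ta|ta] := leP a.1 t.
      have e2 : a.2 = t by apply: fixt => //; rewrite -sl.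
      by rewrite (fixt _ a1 ta) e2.
    by apply: hl; rewrite mem_filter ta.
  have [ft gt] := id' t (ltW tr').
  exists f', g'; split; [exact: ext | exact: ext | by move=> x xr; apply: id'; lra |].
  move=> A hA a aS; have [ta|ta] := leP a t.
    by left; rewrite (fixt a).
  have [|h|[L [h1 h2]]] := H' A hA a; first by rewrite mem_filter ta.
    by left.
  by right; exists L; split=> // x /h2; lra.
have {nst} st' : s < t by lra.
have within_lo l : (forall a, a \in l -> (a.1 <= t) = (a.2 <= t)) ->
    (forall a, a \in l -> a.1 \in S /\ a.2 \in S) -> within (lo l) s t.
  move=> sl Sl a; rewrite mem_filter => /andP[ta al].
  by have [a1 a2] := Sl _ al; rewrite !smin // -sl // ta.
have [||//|//|//|//|||f0 [g0 [pf0 qg0 id0 H0]]] :=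
  @block_ladder (lo p) (lo q) S r s t r' (isoF _ _ hp) (isoF _ _ hq).
- exact: within_lo.
- exact: within_lo.
- by move=> a; rewrite -filter_cat mem_filter => /andP[_ /hS].
- move=> c cS /andP[sc ct].
  have : c \notin T by apply/negP => /tmin; lra.
  rewrite mem_filter cS andbT negbK => /hasP[a aa ca]; apply/hasP; exists a => //.
  rewrite -filter_cat mem_filter aa andbT.
  by case/orP: (ca) => /andP[h1 h2]; [lra | rewrite side //; lra].
(* All four automorphisms fix [r'], where the first block is glued to the rest. *)
pose f x := if x <= r' then f0 x else f' x.
pose g x := if x <= r' then g0 x else g' x.
have [f0r g0r] := id0 r' (or_intror (lexx _)).
have [f'r g'r] := id' r' (lexx _).
have ext l (h0 h' : rat -> rat) : (forall a, a \in l -> a.1 \in S /\ a.2 \in S) ->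
    Ubasic (lo l) h0 -> Ubasic (hi l) h' -> h0 r' = h' r' ->
    Ubasic l (fun x => if x <= r' then h0 x else h' x).
  move=> Sl [a0 l0] [a' l'] er; split; first exact: glue_aut.
  move=> a al; have [a1 a2] := Sl _ al; case: (gap _ a1) => ta.
    by rewrite (_ : a.1 <= r') ?l0 ?mem_filter ?ta //; lra.
  by rewrite leNgt ta /= l' // mem_filter al andbT; lra.
exists f, g; split.
- by apply: ext => //; rewrite f0r f'r.
- by apply: ext => //; rewrite g0r g'r.
- move=> x xr; rewrite /f /g (_ : x <= r'); last lra.
  by apply: id0; left.
move=> A hA a aS; case: (gap _ aS) => ta.
  have [A0 hA0] : exists A0, represents f0 g0 A0.
    by apply: represents_ex; [case: pf0 | case: qg0].
  have [L [h1 h2]] := H0 A0 hA0.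
  have [|L' [e1 e2]] := @ladder_agree f g A f0 g0 A0 L hA hA0.
    by move=> x /h2/andP[_ xr]; rewrite /f /g ltW.
  right; exists L'; rewrite e1 e2; split; first by apply: h1; rewrite smin.
  by move=> x /h2/andP[].
have [A1 hA1] : exists A1, represents f' g' A1.
  by apply: represents_ex; [case: pf' | case: qg'].
have aS' : a \in S' by rewrite mem_filter aS andbT; lra.
have [[fa ga]|[L [h1 h2]]] := H' A1 hA1 a aS'.
  by left; rewrite /f /g leNgt ta.
have [|L' [e1 e2]] := @ladder_agree f g A f' g' A1 L hA hA1.
  by move=> x /h2 xr; rewrite /f /g leNgt xr.
right; exists L'; rewrite e1 e2; split=> // x /h2; lra.
Qed.

(** * Words close to the identity *)

(* The block [f^k g^k] prevents the word from being read inside a finite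
   partial isomorphism of size less than [k], except at a common fixed point. *)
Definition good_word k (w : seq letter) : Prop := reduced w /\
  exists w1 w2, w = w1 ++ nseq k (false, false) ++ nseq k (true, false) ++ w2.

Lemma winv_nseq k l : winv (nseq k l) = nseq k (linv l).
Proof. by rewrite /winv map_nseq rev_nseq. Qed.

Definition fkgk k := nseq k (false, false) ++ nseq k (true, false) ++
  nseq k (false, true) ++ nseq k (true, true).

(** On the top part one generator is the identity and the other preserves that part forwards, so the
    commutator of the powers collapses to a power followed by its inverse. *)
Lemma commutator_top f g A (L : ladder A) k t : represents f g A ->
  top L 0 t -> wact A (fkgk k) t = t.
Proof.
move=> hA; have [i hi] := top_gen L.
have iter_top : forall n t, top L 0 t -> top L 0 (wact A (nseq n (~~ i, false)) t).
  elim=> // n IH x hx; rewrite wact_cons; apply: IH; exact: (hi _ hx).2.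
have fix_top n e x : top L 0 x -> wact A (nseq n (i, e)) x = x.
  by move=> hx; apply: wact_nseq_fixed; exact: (hi _ hx).1.
move=> ht; have ht' := iter_top k _ ht.
have back := wactK hA (nseq k (~~ i, false)) t; move: back; rewrite winv_nseq /linv /=.
rewrite /fkgk !wact_cat; move: fix_top ht'; clear -ht; case: i => /= fix_top ht' back.
  by rewrite (fix_top k false) // back fix_top.
by rewrite (fix_top k false t) // fix_top.
Qed.

(** The commutator starts with [f] and ends with the inverse of [g]. If [u] ends in a positive
    letter, [winv u] starts with a negative one, so nothing cancels at either junction. *)
Lemma good_wordP u k : reduced u -> nilp u \/ ~~ (last (true, false) u).2 ->
  good_word k.+1 (u ++ fkgk k.+1 ++ winv u).
Proof.
move=> ru hu; split; last first.
  by exists u, (nseq k.+1 (false, true) ++ nseq k.+1 (true, true) ++ winv u);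
    rewrite /fkgk -!catA.
have lastn l0 l : last l0 (nseq k.+1 l) = l by elim: k => //= n; case: n.
have rf : reduced (fkgk k.+1).
  rewrite /fkgk; do 3![apply: (@reduced_cat (true, false));
    [exact: reduced_nseq | | by apply: Or33; rewrite lastn]].
  exact: reduced_nseq.
have rb : reduced (fkgk k.+1 ++ winv u).
  apply: (@reduced_cat (true, false)) => //; first exact: reduced_winv.
  case/lastP: u ru hu => [|u l] ru hu; first by apply: Or32.
  apply: Or33; rewrite /winv map_rcons rev_rcons /fkgk !last_cat lastn /=.
  by case: hu; [rewrite /nilp size_rcons | rewrite last_rcons; case: l {ru} => -[] []].
apply: (@reduced_cat (true, false)) => //; case: hu => h; first by apply: Or31.
by apply: Or33; move: h; rewrite /fkgk /=; case: (last _ u) => -[] [].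
Qed.

(** Finite choice: the ladders, known only to exist, are collected in a list that [push_up] can
    process. *)
Lemma ladder_list A (S : seq rat) (Q : rat -> Prop) :
  (forall a, a \in S -> Q a \/ exists L : ladder A, bot L 0 a) ->
  exists todo : seq (ladder A * rat),
    (forall L t, List.In (L, t) todo -> bot L 0 t) /\
    (forall a, a \in S -> Q a \/ exists L, List.In (L, a) todo).
Proof.
elim: S => [|a S IH] H; first by exists [::].
have [|todo [h1 h2]] := IH; first by move=> b bS; apply: H; rewrite inE bS orbT.
have [Qa|[L La]] := H a (mem_head _ _).
  exists todo; split=> // b; rewrite inE => /predU1P[->|/h2//]; by left.
exists ((L, a) :: todo); split=> [L' t [[<- <-]//|/h1//]|b].
rewrite inE => /predU1P[->|/h2[|[L' h]]]; [|by left|]; right.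
  by exists L; left.
by exists L'; right.
Qed.

(** After a structured extension, one word [u] brings all points of [S] that are not common fixed
    points to the top of their ladders, where the commutator acts trivially; its conjugate by [u]
    fixes [S]. *)
Lemma good_word_dense p q (S : seq rat) k : partial_iso p -> partial_iso q ->
  exists f g w, [/\ Ubasic p f, Ubasic q g, good_word k.+1 w &
    forall A, represents f g A -> forall a, a \in S -> wact A w a = a].
Proof.
move=> hp hq.
pose S0 := S ++ map fst (p ++ q) ++ map snd (p ++ q).
have [r hr] : exists r, forall x, x \in S0 -> r < x.
  elim: S0 => [|y s [r hr]]; first by exists 0.
  exists (Order.min r (y - 1)) => x; rewrite inE gt_min => /predU1P[->|/hr ->] //.
  by apply/orP; right; lra.
have [|f [g [pf qg _ H]]] := @structured_extension _ p q S0 r (leqnn _) hp hq _ hr.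
  by move=> a ap; rewrite /S0 !mem_cat !(map_f _ ap) !orbT.
have [hf _] := pf; have [hg _] := qg.
have [A hA] := represents_ex hf hg.
have [|todo [h1 h2]] := @ladder_list A S (fun a => f a = a /\ g a = a).
  move=> a aS; have [|h|[L [hL _]]] := H A hA a; first by rewrite mem_cat aS.
    by left.
  by right; exists L.
have [//|//|u hu] := @push_up A todo [::] [::].
have [u1 ru1 e1] := reduce_ex u.
have top_pos (L : ladder A) i t : top L 0 t -> top L 0 (A (i, false) t).
  have [j hj] := top_gen L => /[dup] ht /hj[h3 h4].
  have [->|ne] := eqVneq i j; first by rewrite h3.
  by have -> : i = ~~ j by case: i j ne {hj h3 h4} => -[].
have [u2 [ru2 lu2 hu2]] : exists u2, [/\ reduced u2,
    nilp u2 \/ ~~ (last (true, false) u2).2 &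
    forall L t, List.In (L, t) todo -> top L 0 (wact A u2 t)].
  have hu1 L t : List.In (L, t) todo -> top L 0 (wact A u1 t).
    by move=> h; rewrite (e1 _ _ _ hA); apply: hu; right.
  have [l2|l2] := boolP (last (true, false) u1).2; last by exists u1; split; auto.
  set l := last _ u1 in l2.
  (* Positive letters preserve the top parts, and the letter of the other generator cannot cancel
     the last one. *)
  exists (u1 ++ [:: (~~ l.1, false)]); split.
  - apply: (@reduced_cat (true, false)) => //; apply: Or33 => /=.
    by rewrite -/l; case: l l2 => -[] [].
  - by right; rewrite last_cat.
  - by move=> L t /hu1; rewrite wact_cat; apply: top_pos.
exists f, g, (u2 ++ fkgk k.+1 ++ winv u2); split=> //; first exact: good_wordP.
move=> A' hA' a aS.
have eA l x : A' l x = A l x by apply: (@represents_agree f g A' f g A (fun=> True)).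
have ew w x : wact A' w x = wact A w x.
  by elim: w x => // l w IHw x; rewrite !wact_cons eA.
rewrite ew; have [[fa ga]|[L hL]] := h2 a aS; first exact: (wact_fixed hA).
by rewrite wact_cat [wact _ _ _]wact_cat (commutator_top _ hA (hu2 _ _ hL)) (wactK hA).
Qed.

(** * Topological similarity in terms of words *)

Lemma gen_aut f g h : is_aut f -> is_aut g -> gen f g h -> is_aut h.
Proof.
move=> hf hg; elim=> // [|h1 h2 _ a1 _ a2|h1 h2 _ a1 c1 c2]; first exact: id_aut.
  exact: comp_aut.
exact: (inv_aut a1).
Qed.

Section WordGen.
Variables (f g : rat -> rat) (A : letter -> rat -> rat).
Hypothesis hA : represents f g A.

Let AE i : A (i, false) = if i then g else f.
Proof.
by case: i; apply: functional_extensionality; [exact: rep_g hA | exact: rep_f hA].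
Qed.

Lemma gen_wact w : gen f g (wact A w).
Proof.
have pos i : gen f g (A (i, false)) by rewrite AE; case: i; constructor.
have genl l : gen f g (A l).
  case: l => i [] //; apply: (gen_inv (pos i)); first exact: (rep_K hA (i, false)).
  exact: (rep_VK hA (i, false)).
elim: w => [|l w IH]; first exact: gen_id.
exact: (gen_mul IH (genl l)).
Qed.

Lemma morph_wact f1 g1 B (phi : (rat -> rat) -> rat -> rat) : represents f1 g1 B ->
  phi f = f1 -> phi g = g1 -> (forall h, gen f g h -> gen f1 g1 (phi h)) ->
  (forall h k, gen f g h -> gen f g k -> phi (h \o k) = phi h \o phi k) ->
  forall w, phi (wact A w) = wact B w.
Proof.
move=> hB pf pg pgen pmul.
have BE i : B (i, false) = if i then g1 else f1.
  by case: i; apply: functional_extensionality; [exact: rep_g hB | exact: rep_f hB].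
have genl l : gen f g (A l) := gen_wact [:: l].
(* [phi id] is an idempotent automorphism; injectivity makes it the identity. *)
have pid : phi id = id.
  apply: functional_extensionality => x.
  have hp : is_aut (phi id).
    by apply: (gen_aut (rep_fst hB) (rep_snd hB)); apply: pgen; constructor.
  apply: (aut_inj hp); change ((phi id \o phi id) x = phi id x).
  by rewrite -pmul //; constructor.
have pl l : phi (A l) = B l.
  have pos i : phi (A (i, false)) = B (i, false) by rewrite AE BE; case: i.
  case: l => i [] //; apply: functional_extensionality => x.
  rewrite -{1}(rep_VK hB (i, false) x) -pos.
  change ((phi (A (i, true)) \o phi (A (i, false))) (B (i, true) x) = B (i, true) x).
  rewrite -pmul // (_ : A (i, true) \o A (i, false) = id) ?pid //.
  by apply: functional_extensionality; exact: (rep_K hA (i, false)).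
elim=> [|l w IH] //.
change (phi (wact A w \o A l) = wact B w \o B l).
by rewrite pmul ?IH ?pl //; exact: gen_wact.
Qed.

(** The preimage of the open stabilizer of [x] contains a basic neighbourhood of the identity; its
    finite domain is [S]. *)
Lemma continuous_fixes f1 g1 B phi : represents f1 g1 B ->
  (forall w, phi (wact A w) = wact B w) ->
  sub_continuous G_open (gen f g) (gen f1 g1) phi ->
  forall x, exists S : seq rat, forall w,
    {in S, wact A w =1 id} -> wact B w x = x.
Proof.
move=> hB pw cont x.
have [|_ [U [[_ Uop] UE]]] := cont (fun k => gen f1 g1 k /\ k x = x).
  split; first by move=> k [].
  exists (Ubasic [:: (x, x)]); split.
    split=> [h []//|h hh]; exists [:: (x, x)]; split=> //.
    exact: Ubasic_partial_iso hh.
  move=> k gk; split=> [[_ kx]|[_ h]].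
    split; first exact: (gen_aut (rep_fst hB) (rep_snd hB)).
    by move=> a; rewrite inE => /eqP ->.
  by split=> //; apply: (h (x, x)); exact: mem_head.
have [p [_ [[_ idp] pU]]] : exists p, partial_iso p /\ Ubasic p id /\
    forall h, Ubasic p h -> U h.
  apply: Uop; apply/UE; first exact: gen_id.
  by split; [exact: gen_id | rewrite (pw [::]); split; [exact: gen_id|]].
exists (map fst p) => w hw.
have : U (wact A w).
  apply: pU; split; first exact: (wact_aut hA).
  by move=> a ap; rewrite hw ?map_f // -(idp a ap).
by move=> /(UE _ (gen_wact w))[_ []]; rewrite pw.
Qed.

End WordGen.

Lemma top_similar_fixes f g f1 g1 A B : represents f g A -> represents f1 g1 B ->
  top_similar f g f1 g1 ->
  (forall x, exists S : seq rat, forall w, {in S, wact A w =1 id} -> wact B w x = x) /\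
  (forall x, exists S : seq rat, forall w, {in S, wact B w =1 id} -> wact A w x = x).
Proof.
move=> hA hB [phi [psi [pf [pg [pgen [_ [psiphi [_ [pmul [cphi cpsi]]]]]]]]]].
have pw := morph_wact hA hB pf pg pgen pmul.
split; first exact: (continuous_fixes hA hB pw).
(* The values of [psi] on words follow from those of [phi] and [psi (phi h) = h]. *)
apply: (continuous_fixes hB hA _ cpsi) => w.
by rewrite -pw psiphi //; exact: (gen_wact hA).
Qed.

(** * Meagerness *)

Lemma Ubasic_open p : G_open (Ubasic p).
Proof.
by split=> [f []//|f hf]; exists p; split=> //; exact: Ubasic_partial_iso hf.
Qed.

(** The pair [(f', g')] lies in both boxes: the first puts it in the closure of [N], the second is a
    neighbourhood of it that misses [N]. *)
Lemma nowhere_denseP (N : pset ((rat -> rat) * (rat -> rat))) :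
  (forall p q f g, Ubasic p f -> Ubasic q g ->
    exists f' g' p' q', [/\ Ubasic p f', Ubasic q g', Ubasic p' f', Ubasic q' g' &
      forall y, Ubasic p' y.1 -> Ubasic q' y.2 -> ~ N y]) ->
  nowhere_dense G2 G2_open N.
Proof.
move=> H x [O [[OG Oop] [Ox OC]]].
have [U [V [[_ Uop] [[_ Vop] [Ux [Vx UV]]]]]] := Oop x Ox.
have [p [_ [px pU]]] := Uop _ Ux; have [q [_ [qx qV]]] := Vop _ Vx.
have [f [g [p' [q' [pf qg pf' qg' HN]]]]] := H p q _ _ px qx.
have [_ /(_ (fun y => Ubasic p' y.1 /\ Ubasic q' y.2))] : Defs.closure G2 G2_open N (f, g).
  by apply/OC/UV; [exact: pU | exact: qV].
case=> //=; last by move=> y [[/HN h1 /h1 h2] Ny].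
split=> [y [[? _] [? _]]//|y [h1 h2]].
exists (Ubasic p'), (Ubasic q'); split; first exact: Ubasic_open.
by split; first exact: Ubasic_open.
Qed.

(** The letters act in only one way for a given pair of automorphisms, so quantifying over [A] gives
    a property of the pair alone. *)
Definition fixes (w : seq letter) (S : seq rat) (f g : rat -> rat) :=
  forall A, represents f g A -> {in S, wact A w =1 id}.

Lemma fixes_open w S f g : is_aut f -> is_aut g -> fixes w S f g ->
  exists p q, [/\ Ubasic p f, Ubasic q g &
    forall f' g', Ubasic p f' -> Ubasic q g' -> fixes w S f' g'].
Proof.
move=> hf hg hw; have [A hA] := represents_ex hf hg.
have [p [q [pf qg H]]] := wact_locally_constant w S hA.
exists p, q; split=> // f' g' pf' qg' A' hA' a aS.
by rewrite (H _ _ _ hA') // hw.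
Qed.

Lemma no_good_word_nowhere_dense S k : nowhere_dense G2 G2_open
  (fun x => ~ exists2 w, good_word k.+1 w & fixes w S x.1 x.2).
Proof.
apply: nowhere_denseP => p q f0 g0 /Ubasic_partial_iso hp /Ubasic_partial_iso hq.
have [f [g [w [pf qg gw hw]]]] := good_word_dense S k hp hq.
have [|||p' [q' [pf' qg' H]]] := @fixes_open w S f g; [by case: pf|by case: qg| |].
  by move=> A hA a aS; exact: hw.
exists f, g, p', q'; split=> // y h1 h2; apply; exists w => //.
exact: H.
Qed.

(** Pairs with trivial first coordinate are covered separately; every other pair has a point moved
    by its first coordinate. *)
Lemma identity_nowhere_dense : nowhere_dense G2 G2_open
  (fun x => forall t, x.1 t = t).
Proof.
apply: nowhere_denseP => p q f0 g0 pf0 qg0.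
have [x x0 hx] := right_gap (map fst p) 0.
have xp : x \notin map fst p.
  by apply/negP => h; have [] := hx x h; lra.
have [|f [g [pf qg H]]] :=
    @free_extension p q [:: x] [:: (false, false)] x (Ubasic_partial_iso pf0)
      (Ubasic_partial_iso qg0) isT.
  by move=> /= [y /(map_f fst) /= h _]; rewrite h in xp.
have [hf _] := pf; have [hg _] := qg.
have [A hA] := represents_ex hf hg.
exists f, g, [:: (x, f x)], [::]; split=> //.
- by split=> // a; rewrite inE => /eqP ->.
move=> y [_ /(_ _ (mem_head _ _)) /= yx] _ /(_ x); rewrite yx => fx.
have := H A hA; rewrite wact_cons (rep_f hA) fx.
by rewrite /wact /= inE eqxx.
Qed.

Lemma stabilizer_nowhere_dense f2 g2 (S : seq rat) x :
  (forall k, exists2 w, good_word k.+1 w & fixes w S f2 g2) ->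
  nowhere_dense G2 G2_open (fun y => (y.1 x <> x \/ y.2 x <> x) /\
    forall w, fixes w S f2 g2 -> fixes w [:: x] y.1 y.2).
Proof.
move=> H; apply: nowhere_denseP => p0 q0 f0 g0 pf0 qg0.
have [hf0 _] := pf0; have [hg0 _] := qg0.
(* Recording the values at [x] decides whether [x] is a common fixed point throughout the box; if it
   is, the box misses the set. *)
pose p := (x, f0 x) :: p0; pose q := (x, g0 x) :: q0.
have pf : Ubasic p f0 by apply/Ubasic_cons.
have qg : Ubasic q g0 by apply/Ubasic_cons.
have [fx|nfx] := classic (f0 x = x /\ g0 x = x).
  exists f0, g0, p, q; split=> // y [_ /(_ _ (mem_head _ _)) /= h1].
  by move=> [_ /(_ _ (mem_head _ _)) /= h2] [[]]; rewrite ?h1 ?h2; case: fx.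
(* The exponent, one more than this sum, exceeds the sizes of both [p] and [q]. *)
have [w [rw [w1 [w2 wE]]] hw] := H (size p + size q)%N.
have [A0 hA0] := represents_ex hf0 hg0.
(* Reading both powers forces the point [y] reached after [w1] to be a common fixed point; then [w1]
   fixes [y], so [x = y], a contradiction. *)
have nd : ~ wdef p q w x.
  rewrite wE => /(wdef_cat hA0 pf qg)[_] /(wdef_cat hA0 pf qg)[].
  set y := wact A0 w1 x => /(wdef_nseq hA0 pf qg) fy.
  have {}fy : A0 (false, false) y = y.
    by apply: fy; rewrite /lgraph /= ltnS leq_addr.
  rewrite (wact_nseq_fixed _ fy) => /(wdef_cat hA0 pf qg)[/(wdef_nseq hA0 pf qg) gy _].
  have {}gy : A0 (true, false) y = y.
    by apply: gy; rewrite /lgraph /= ltnS leq_addl.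
  rewrite (rep_f hA0) in fy; rewrite (rep_g hA0) in gy.
  apply: nfx; suff -> : x = y by [].
  by apply: (aut_inj (wact_aut hA0 w1)); rewrite -/y (wact_fixed hA0).
have [f [g [pf1 qg1 ne]]] := free_extension [:: x] (Ubasic_partial_iso pf)
  (Ubasic_partial_iso qg) rw nd.
have [hf _] := pf1; have [hg _] := qg1.
have [A hA] := represents_ex hf hg.
have [p' [q' [pf' qg' E]]] := wact_locally_constant w [:: x] hA.
exists f, g, p', q'; split=> //.
- by case/Ubasic_cons: pf1.
- by case/Ubasic_cons: qg1.
move=> y h1 h2 [_ /(_ w hw) hy].
have [A' hA'] := represents_ex h1.1 h2.1.
have := ne A hA; rewrite inE -(E _ _ _ hA' h1 h2 x (mem_head _ _)).
by rewrite (hy A' hA' x (mem_head _ _)) eqxx.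
Qed.

Lemma meager_countable (I : countType) (C : pset ((rat -> rat) * (rat -> rat)))
  (N : I -> pset ((rat -> rat) * (rat -> rat))) :
  (forall i, nowhere_dense G2 G2_open (N i)) ->
  (forall x, C x -> exists i, N i x) -> meager G2 G2_open C.
Proof.
move=> hN cover.
(* Numbers that code no index receive the empty set, whose closure is empty. *)
exists (fun n => if unpickle n is Some i then N i else fun=> False); split.
  move=> n; case: unpickle => // x [O [Oop [Ox /(_ _ Ox) [_ /(_ O Oop Ox)]]]].
  by case=> y [].
by move=> x /cover[i Ni]; exists (pickle i); rewrite pickleK.
Qed.

Theorem theorem3p13 (f1 g1 : rat -> rat) :
  is_aut f1 -> is_aut g1 ->
  meager G2 G2_open (fun x => G2 x /\ top_similar x.1 x.2 f1 g1).
Proof.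
move=> hf1 hg1; have [A1 hA1] := represents_ex hf1 hg1.
pose R (x : (rat -> rat) * (rat -> rat)) :=
  forall S k, exists2 w, good_word k.+1 w & fixes w S x.1 x.2.
have [[[f2 g2] [[/= [hf2 hg2] sim2] R2]]|noR] :=
    classic (exists x, (G2 x /\ top_similar x.1 x.2 f1 g1) /\ R x); last first.
  apply: (@meager_countable (seq rat * nat)%type _ (fun i x =>
    ~ exists2 w, good_word i.2.+1 w & fixes w i.1 x.1 x.2)).
    by move=> i; exact: no_good_word_nowhere_dense.
  move=> x Cx; apply: NNPP => h; apply: noR; exists x; split=> // S k.
  by apply: NNPP => h'; apply: h; exists (S, k).
have [A2 hA2] := represents_ex hf2 hg2.
have [fix21 _] := top_similar_fixes hA2 hA1 sim2.
(* [None] indexes the pairs with trivial first coordinate; [Some (x, s)] those for which [s]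
   controls the moved point [x]. *)
apply: (@meager_countable (option (rat * seq rat)) _ (fun i =>
  if i is Some (x, s) then fun y => (y.1 x <> x \/ y.2 x <> x) /\
    forall w, fixes w s f2 g2 -> fixes w [:: x] y.1 y.2
  else fun y => forall t, y.1 t = t)).
  move=> [[x S]|]; last exact: identity_nowhere_dense.
  by apply: stabilizer_nowhere_dense => k; exact: R2.
move=> [f g] [[/= hf hg] sim]; have [A hA] := represents_ex hf hg.
have [_ fix1] := top_similar_fixes hA hA1 sim.
have [idf|/not_all_ex_not[x fx]] := classic (forall t, f t = t); first by exists None.
have [S1 hS1] := fix1 x.
(* Two continuity estimates compose: fixing [S] under the second pair forces fixing [S1] under the
   reference pair, hence fixing [x] under [(f, g)]. *)
have [S hS] : exists S : seq rat, forall w,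
    {in S, wact A2 w =1 id} -> {in S1, wact A1 w =1 id}.
  elim: S1 {hS1} => [|a S1 [S hS]]; first by exists [::].
  have [Sa hSa] := fix21 a; exists (Sa ++ S) => w hw b.
  rewrite inE => /predU1P[->|bS].
    by apply: hSa => c cS; apply: hw; rewrite mem_cat cS.
  by apply: (hS w) => // c cS; apply: hw; rewrite mem_cat cS orbT.
exists (Some (x, S)); split; first by left.
move=> w hw A' hA' b; rewrite inE => /eqP ->.
have -> : wact A' w x = wact A w x.
  elim: w x {hw fx hS1} => // l w IH x; rewrite !wact_cons.
  by rewrite (@represents_agree f g A' f g A (fun=> True) hA' hA).
by apply: hS1; apply: hS; apply: hw.
Qed.
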